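(* (Generalized Leibniz Integral Rule) Let $U\subseteq\mathbb R^n$ be open. Let $\{J_t\}$ be a one-parameter family in ${}'\mathcal B_k(U)$ which is differentiable in time, and let $\{\omega_t\}$ be a one-parameter family in $\mathcal B_k(U)$ which is differentiable in time. Then $$\frac{\partial}{\partial t}\int_{J_t}\omega_t=\int_{\frac{\partial}{\partial t}J_t}\omega_t+\int_{J_t}\frac{\partial}{\partial t}\omega_t .$$
   Context: A family $J_t\in{}'\mathcal B_k(U)$ is differentiable in time if $\frac{\partial}{\partial t}J_t=\lim_{h\to0}(J_{t+h}-J_t)/h$ exists in ${}'\mathcal B_k(U)$; similarly $\frac{\partial}{\partial t}\omega_t=\lim_{h\to0}(\omega_{t+h}-\omega_t)/h$ in $\mathcal B_k(U)$. Spaces. Fix the standard inner product on $\mathbb R^n$, extended to $k$-vectors by $\langle u_1\wedge\dots\wedge u_k,v_1\wedge\dots\wedge v_k\rangle=\det(\langle u_i,v_j\rangle)$. A simple $k$-vector has mass $\|\alpha\|=\sqrt{\langle\alpha,\alpha\rangle}$; a general one has mass $\|\alpha\|=\inf\{\sum\|\alpha_j\|:\alpha=\sum\alpha_j,\ \alpha_j \text{ simple}\}$. $\mathcal A_k(U)$ is the space of Dirac $k$-chains in $U$: finite formal sums $\sum(p_i;\alpha_i)$, $p_i\in U$, $\alpha_i\in\Lambda_k(\mathbb R^n)$. With $T_u(p;\alpha)=(p+u;\alpha)$ and $\sigma=u_1\circ\dots\circ u_j$ a symmetric product of vectors, put $\|\sigma\|=\|u_1\|\cdots\|u_j\|$ and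 $\Delta_{\sigma}(p;\alpha)=(T_{u_1}-I)\cdots(T_{u_j}-I)(p;\alpha)$ (for $j=0$: $(p;\alpha)$, $\|\sigma\|=1$); this has order $j$ and is inside $U$ if the convex hull of its support is contained in $U$. $\|A\|_{B^{r,U}}=\inf\{\sum_i\|\sigma_i\|\|\alpha_i\|: A=\sum_i\Delta_{\sigma_i}(p_i;\alpha_i)$ (finite sum), all terms inside $U$, orders $\le r\}$; $\hat{\mathcal B}_k^r(U)$ is the completion of $\mathcal A_k(U)$ in this norm; ${}'\mathcal B_k(U)=\varinjlim_r\hat{\mathcal B}_k^r(U)$ with the locally convex inductive limit topology (linking maps induced by the identity). A $k$-form on $U$ is a linear functional $\omega$ on $\mathcal A_k(U)$; $\|\omega\|_{B^{r,U}}=\max_{0\le j\le r}\sup\{|\omega(\Delta_\sigma(p;\alpha))|:\sigma\text{ of order }j,\ \Delta_\sigma(p;\alpha)\text{ inside }U,\ \|\sigma\|\|\alpha\|=1\}$; $\mathcal B_k(U)$ is the Fréchet space of forms with all these norms finite (smooth $k$-forms on $U$ with all derivatives bounded), topologized by these seminorms. $\int_J\omega=\lim\omega(A_i)$, where $A_i\in\mathcal A_k(U)$ converge to a representative of $J$ in some $\hat{\mathcal B}_k^r(U)$. *)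

(* Defs.v *)
From HB Require Import structures.
From mathcomp Require Import all_boot all_order all_algebra all_fingroup.
From mathcomp Require Import all_classical all_reals all_analysis.
From mathcomp Require Import ring lra.
From mathcomp Require Import generic_quotient.

Set Implicit Arguments.
Unset Strict Implicit.
Unset Printing Implicit Defensive.
Import Order.TTheory GRing.Theory Num.Theory.
Import numFieldNormedType.Exports.
Local Open Scope classical_set_scope.
Local Open Scope quotient_scope.
Local Open Scope ring_scope.

(* strictly increasing maps {0, .., k-1} -> {0, .., n-1}; they index the
   standard basis (e_{f 0} /\ .. /\ e_{f (k-1)})_f of the k-vectors of R^n *)
Definition multi_index (n k : nat) := {f : {ffun 'I_k -> 'I_n} |
  [forall i : 'I_k, forall j : 'I_k, (i < j)%N ==> (f i < f j)%N]}.
HB.instance Definition _ n k := Finite.on (multi_index n k).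

Section Cauchy_Binet.
Variables (R : comNzRingType) (n k : nat).

Lemma multi_index_ltn (f : multi_index n k) (i j : 'I_k) :
  (i < j)%N -> (val f i < val f j)%N.
Proof. by have /forallP/(_ i)/forallP/(_ j)/implyP := valP f. Qed.

Lemma multi_index_inj (f : multi_index n k) : injective (val f).
Proof.
move=> i j fij; apply/val_inj/eqP.
by case: ltngtP => // /(multi_index_ltn f); rewrite fij ltnn.
Qed.

Lemma multi_index_sorted (f : multi_index n k) :
  sorted ltn [seq (val f i : nat) | i <- enum 'I_k].
Proof.
rewrite sorted_map; apply: (@sub_sorted _ (relpre val ltn)).
  by move=> i j /=; exact: multi_index_ltn.
by rewrite -sorted_map val_enum_ord iota_ltn_sorted.
Qed.

Lemma multi_index_factor (g : {ffun 'I_k -> 'I_n}) : injective g ->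
  exists (f : multi_index n k) (s : 'S_k), g = [ffun i => val f (s i)].
Proof.
move=> g_inj.
pose t := sort leq [seq (g i : nat) | i <- enum 'I_k].
have sz_t : size t == k by rewrite size_sort size_map size_enum_ord.
have : perm_eq [tuple (g i : nat) | i < k] (Tuple sz_t).
  by rewrite perm_sym /= /t perm_sort.
move=> /tuple_permP[s gs].
have gsE i : g i = tnth (Tuple sz_t) (s i) :> nat.
  have := congr1 (nth 0%N ^~ i) gs.
  by rewrite -!tnth_nth !tnth_mktuple.
have t_ltn : sorted ltn t.
  rewrite ltn_sorted_uniq_leq sort_sorted ?andbT; last exact: leq_total.
  rewrite sort_uniq map_inj_in_uniq ?enum_uniq// => i j _ _ /val_inj.
  exact: g_inj.
pose f := [ffun i => g ((s^-1)%g i)].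
have fP : [forall i : 'I_k, forall j : 'I_k, (i < j)%N ==> (f i < f j)%N].
  apply/forallP => i; apply/forallP => j; apply/implyP => ij.
  rewrite !ffunE !gsE !permKV !(tnth_nth 0%N) /=.
  by apply: (sorted_ltn_nth ltn_trans) => //; rewrite inE (eqP sz_t).
exists (exist _ f fP), s; apply/ffunP => i.
by rewrite !ffunE /= ?ffunE permK.
Qed.

Let pre (fs : multi_index n k * 'S_k) : {ffun 'I_k -> 'I_n} :=
  [ffun i => val fs.1 (fs.2 i)].

Lemma multi_index_factor_inj : injective pre.
Proof.
move=> [f s] [f' s'] e.
have eE i : val f (s i) = val f' (s' i).
  by have := congr1 (fun h : {ffun _ -> _} => h i) e; rewrite !ffunE.
have ff' : f = f'.
  apply/val_inj/ffunP => i; apply/val_inj.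
  have : [seq (val f i : nat) | i <- enum 'I_k] =
         [seq (val f' i : nat) | i <- enum 'I_k].
    apply: (irr_sorted_eq ltn_trans ltnn) => [||x]; try exact: multi_index_sorted.
    apply/mapP/mapP => -[j _ ->].
      exists (s' ((s^-1)%g j)); first by rewrite mem_enum.
      by rewrite -eE permKV.
    exists (s ((s'^-1)%g j)); first by rewrite mem_enum.
    by rewrite eE permKV.
  move=> /(congr1 (nth 0%N ^~ i)).
  by rewrite !(nth_map i) -?enumT ?size_enum_ord// ?nth_ord_enum.
rewrite -ff' in eE *; congr pair; apply/permP => i.
exact: (@multi_index_inj f).
Qed.

Lemma det_mulmx_ffun (A : 'M[R]_(k, n)) (B : 'M[R]_(n, k)) :
  \det (A *m B) = \sum_(g : {ffun 'I_k -> 'I_n})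
     (\prod_i A i (g i)) * \det (rowsub g B).
Proof.
rewrite /determinant.
under eq_bigr => s _.
  under eq_bigr => i _ do rewrite mxE.
  rewrite bigA_distr_bigA big_distrr /=.
  over.
rewrite exchange_big /=; apply: eq_bigr => g _.
rewrite big_distrr /=; apply: eq_bigr => s _.
rewrite big_split /= mulrCA; congr (_ * (_ * _)).
by apply: eq_bigr => i _; rewrite !mxE.
Qed.

Lemma Cauchy_Binet (A : 'M[R]_(k, n)) (B : 'M[R]_(n, k)) :
  \det (A *m B) =
  \sum_(f : multi_index n k) \det (colsub (val f) A) * \det (rowsub (val f) B).
Proof.
rewrite det_mulmx_ffun (bigID (fun g : {ffun 'I_k -> 'I_n} => injectiveb g)) /=.
rewrite [X in _ + X]big1 ?addr0; last first.
  move=> g /injectivePn[i [j ij gij]].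
  by rewrite (determinant_alternate ij) ?mulr0// => l; rewrite !mxE gij.
rewrite (eq_bigl (mem (pre @: [set: multi_index n k * 'S_k]%SET))); last first.
  move=> g /=; apply/injectiveP/imsetP => [/multi_index_factor[f [s ->]]|].
    by exists (f, s); rewrite ?inE.
  move=> [[f s] _ ->] i j; rewrite !ffunE => /multi_index_inj.
  exact: perm_inj.
rewrite big_imset /=; last by move=> ? ? _ _; exact: multi_index_factor_inj.
rewrite (eq_bigl xpredT) => [|?]; last by rewrite inE.
rewrite (eq_bigr (fun fs => (fun (f : multi_index n k) (s : 'S_k) => (\prod_i A i (val f (s i))) *
   ((-1) ^+ odd_perm s * \det (rowsub (val f) B))) fs.1 fs.2)); last first.
  move=> [f s] _ /=; congr (_ * _); first by apply: eq_bigr => i _; rewrite ffunE.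
  rewrite (_ : rowsub _ _ = row_perm s (rowsub (val f) B)).
    by rewrite row_permE det_mulmx det_perm.
  by apply/matrixP => i j; rewrite !mxE ffunE.
rewrite -(pair_bigA _ (fun (f : multi_index n k) (s : 'S_k) => (\prod_i A i (val f (s i))) *
   ((-1) ^+ odd_perm s * \det (rowsub (val f) B)))) /=.
apply: eq_bigr => f _; rewrite [X in _ = X * _]/determinant big_distrl /=.
apply: eq_bigr => s _; rewrite mulrCA mulrA; congr (_ * _ * _).
by apply: eq_bigr => i _; rewrite !mxE.
Qed.

End Cauchy_Binet.

Section kvectors.
Variables (R : realType) (n k : nat).

Definition enorm (u : 'rV[R]_n) : R := Num.sqrt (\sum_j u ord0 j ^+ 2).

Definition kvec := {ffun multi_index n k -> R^o}.
HB.instance Definition _ := GRing.Lmodule.on kvec.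

Definition kdot (a b : kvec) : R := \sum_f a f * b f.

Definition wedge (u : 'M[R]_(k, n)) : kvec :=
  [ffun f : multi_index n k => \det (colsub (val f) u) : R^o].

Lemma kdot_wedge (u v : 'M[R]_(k, n)) :
  kdot (wedge u) (wedge v) =
  \det (\matrix_(i, j) \sum_l u i l * v j l).
Proof.
transitivity (\det (u *m v^T)); last first.
  congr (\det _); apply/matrixP => i j; rewrite !mxE.
  by apply: eq_bigr => l _; rewrite mxE.
rewrite Cauchy_Binet; apply: eq_bigr => f _; rewrite !ffunE; congr (_ * _).
by rewrite -det_tr; congr (\det _); apply/matrixP => i j; rewrite !mxE.
Qed.

Definition knorm (a : kvec) : R := Num.sqrt (kdot a a).

(* scalar multiples of wedge products; the scalar only matters for k = 0 *)
Definition simple_kvec (a : kvec) : Prop :=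
  exists c (u : 'M[R]_(k, n)), a = c *: wedge u.

(* extends knorm on simple k-vectors, see mass_simple *)
Definition mass (a : kvec) : R :=
  inf [set x | exists s : seq kvec,
    [/\ forall b, b \in s -> simple_kvec b, a = \sum_(b <- s) b &
        x = \sum_(b <- s) knorm b]].

Lemma kdotC a b : kdot a b = kdot b a.
Proof. by apply: eq_bigr => f _; rewrite mulrC. Qed.

Lemma kdotDl a b c : kdot (a + b) c = kdot a c + kdot b c.
Proof. by rewrite -big_split; apply: eq_bigr => f _ /=; rewrite ffunE mulrDl. Qed.

Lemma kdotZl x a c : kdot (x *: a) c = x * kdot a c.
Proof. by rewrite big_distrr; apply: eq_bigr => f _ /=; rewrite ffunE -mulrA. Qed.

Lemma kdot_ge0 a : 0 <= kdot a a.
Proof. by apply: sumr_ge0 => f _; rewrite -expr2 sqr_ge0. Qed.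

Lemma knorm_ge0 a : 0 <= knorm a. Proof. exact: sqrtr_ge0. Qed.

Lemma sqr_knorm a : knorm a ^+ 2 = kdot a a.
Proof. by rewrite sqr_sqrtr ?kdot_ge0. Qed.

Lemma knormZ x a : knorm (x *: a) = `|x| * knorm a.
Proof.
by rewrite /knorm kdotZl kdotC kdotZl mulrA -expr2 sqrtrM ?sqr_ge0 ?sqrtr_sqr.
Qed.

Lemma knorm0_eq0 a : knorm a = 0 -> a = 0.
Proof.
move=> a0; have := sqr_knorm a; rewrite a0 expr0n /= => /esym/eqP.
rewrite psumr_eq0 => [/allP aP|f _]; last by rewrite -expr2 sqr_ge0.
apply/ffunP => f; rewrite ffunE; apply/eqP.
by have := aP f (mem_index_enum f); rewrite -expr2 sqrf_eq0.
Qed.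

Lemma kdot_le a b : kdot a b <= knorm a * knorm b.
Proof.
have [a0|an0] := eqVneq (knorm a) 0.
  by rewrite (knorm0_eq0 a0) -(scale0r 0) kdotZl mul0r mulr_ge0 ?knorm_ge0.
have [b0|bn0] := eqVneq (knorm b) 0.
  by rewrite (knorm0_eq0 b0) kdotC -(scale0r 0) kdotZl mul0r mulr_ge0 ?knorm_ge0.
have ab0 : 0 < knorm a * knorm b by rewrite mulr_gt0 ?lt0r ?knorm_ge0 ?an0 ?bn0.
have := kdot_ge0 (knorm b *: a - knorm a *: b).
rewrite kdotDl -scaleN1r !kdotZl ![kdot _ (_ + _)]kdotC !kdotDl !kdotZl.
rewrite -!sqr_knorm (kdotC b a) mulN1r -[X in 0 <= X](_ : 2 * (knorm a * knorm b) *
  (knorm a * knorm b - kdot a b) = _); last by ring.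
by rewrite pmulr_rge0 ?subr_ge0// mulr_gt0.
Qed.

Lemma knormD a b : knorm (a + b) <= knorm a + knorm b.
Proof.
rewrite -(@ler_pXn2r _ 2)// ?nnegrE ?addr_ge0 ?knorm_ge0//.
rewrite sqr_knorm kdotDl ![kdot _ (_ + _)]kdotC !kdotDl sqrrD !sqr_knorm.
rewrite (kdotC b a) addrA lerD2r -addrA lerD2l mulr2n.
by rewrite lerD ?kdot_le.
Qed.

Lemma knorm0 : knorm 0 = 0.
Proof. by rewrite -(scale0r 0) knormZ normr0 mul0r. Qed.

Lemma knorm_sum (s : seq kvec) : knorm (\sum_(b <- s) b) <= \sum_(b <- s) knorm b.
Proof.
elim: s => [|b s IH]; first by rewrite !big_nil knorm0.
by rewrite !big_cons (le_trans (knormD _ _))// lerD2l.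
Qed.

Lemma mass_lbound a : lbound [set x | exists s : seq kvec,
    [/\ forall b, b \in s -> simple_kvec b, a = \sum_(b <- s) b &
        x = \sum_(b <- s) knorm b]] (knorm a).
Proof. by move=> _ [s [_ -> ->]]; exact: knorm_sum. Qed.

Lemma multi_index_unique (f g : multi_index n k) :
  (forall i, exists j, val f i = val g j) -> f = g.
Proof.
move=> fg; apply/val_inj/ffunP => i.
have fsub : {subset codom (val f) <= codom (val g)}.
  by move=> x /codomP[j ->]; have [l ->] := fg j; exact: codom_f.
have e : codom (val f) =i codom (val g).
  apply: (uniq_min_size _ _ _).2 => //.
    by rewrite /codom /image_mem map_inj_uniq ?enum_uniq//; exact: multi_index_inj.
  by rewrite !size_codom.
have : [seq (val f i : nat) | i <- enum 'I_k] =
       [seq (val g i : nat) | i <- enum 'I_k].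
  apply: (irr_sorted_eq ltn_trans ltnn) => [||x]; try exact: multi_index_sorted.
  apply/mapP/mapP => -[j _ ->].
    by have [l ->] := fg j; exists l => //; rewrite mem_enum.
  have : val g j \in codom (val f) by rewrite e codom_f.
  by move=> /codomP[l ->]; exists l => //; rewrite mem_enum.
move=> /(congr1 (nth 0%N ^~ i)).
by rewrite !(nth_map i) -?enumT ?size_enum_ord// ?nth_ord_enum => /val_inj.
Qed.

Lemma wedge_basis (f : multi_index n k) :
  wedge (\matrix_(i, j) (val f i == j)%:R) = [ffun g : multi_index n k => (g == f)%:R : R^o].
Proof.
apply/ffunP => g; rewrite !ffunE.
have [->|gf] := eqVneq g f.
  rewrite (_ : colsub _ _ = 1%:M) ?det1//.
  by apply/matrixP => i j; rewrite !mxE (inj_eq (@multi_index_inj _ _ f)).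
have [i fgi] : exists i, forall j, val f i != val g j.
  apply/not_existsP => fg; move/eqP: gf; apply; apply/esym/multi_index_unique.
  move=> i; have /existsNP[j /negP] := fg i.
  by rewrite negbK => /eqP ?; exists j.
rewrite (expand_det_row _ i) big1// => j _.
by rewrite !mxE (negbTE (fgi j)) mul0r.
Qed.

Lemma simple_kvecZ c a : simple_kvec a -> simple_kvec (c *: a).
Proof. by move=> [d [u ->]]; exists (c * d), u; rewrite scalerA. Qed.

Lemma mass_nonempty a : [set x | exists s : seq kvec,
    [/\ forall b, b \in s -> simple_kvec b, a = \sum_(b <- s) b &
        x = \sum_(b <- s) knorm b]] !=set0.
Proof.
pose s := [seq a f *: ([ffun g : multi_index n k => (g == f)%:R : R^o] : kvec) |
            f <- index_enum (multi_index n k)].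
exists (\sum_(b <- s) knorm b), s; split => //.
  by move=> b /mapP[f _ ->]; apply: simple_kvecZ; exists 1, (\matrix_(i, j) (val f i == j)%:R);
    rewrite scale1r wedge_basis.
rewrite big_map; apply/ffunP => g; rewrite sum_ffunE.
rewrite (bigD1 g) //= !ffunE eqxx big1 ?addr0 => [|f fg].
  by rewrite /GRing.scale /= mulr1.
by rewrite !ffunE eq_sym (negbTE fg) scaler0.
Qed.

Lemma knorm_le_mass a : knorm a <= mass a.
Proof. by apply: lb_le_inf; [exact: mass_nonempty|exact: mass_lbound]. Qed.

Lemma mass_simple a : simple_kvec a -> mass a = knorm a.
Proof.
move=> sa; apply/eqP; rewrite eq_le knorm_le_mass andbT.
apply: ge_inf; first by exists (knorm a); exact: mass_lbound.
by exists [:: a]; rewrite !big_seq1; split => // b; rewrite inE => /eqP ->.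
Qed.

Lemma mass_ge0 a : 0 <= mass a.
Proof. exact: le_trans (knorm_ge0 a) (knorm_le_mass a). Qed.

Lemma mass_eq0 a : mass a = 0 -> a = 0.
Proof.
move=> a0; apply: knorm0_eq0; apply/eqP.
by rewrite eq_le knorm_ge0 andbT -a0 knorm_le_mass.
Qed.

Lemma massZ_le c a : mass (c *: a) <= `|c| * mass a.
Proof.
have [->|c0] := eqVneq c 0.
  rewrite scale0r normr0 mul0r mass_simple ?knorm0//.
  by exists 0, 0; rewrite scale0r.
rewrite -ler_pdivrMl ?normr_gt0//; apply: lb_le_inf; first exact: mass_nonempty.
move=> _ [s [ss -> ->]]; rewrite ler_pdivrMl ?normr_gt0//.
apply: ge_inf; first by exists (knorm (c *: \sum_(b <- s) b)); exact: mass_lbound.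
exists [seq c *: b | b <- s]; rewrite !big_map scaler_sumr; split => //.
  by move=> _ /mapP[b bs ->]; exact/simple_kvecZ/ss.
by rewrite mulr_sumr; apply: eq_bigr => b _; rewrite knormZ.
Qed.

Lemma massZ c a : mass (c *: a) = `|c| * mass a.
Proof.
have [->|c0] := eqVneq c 0.
  apply/eqP; rewrite eq_le massZ_le normr0 mul0r; exact: mass_ge0.
apply/eqP; rewrite eq_le massZ_le /= -ler_pdivlMl ?normr_gt0//.
by rewrite -normfV -{1}(scalerK c0 a) massZ_le.
Qed.

Lemma mass0 : mass 0 = 0.
Proof. by rewrite -(scale0r 0) massZ normr0 mul0r. Qed.

End kvectors.

Section dirac_chains.
Variables (R : realType) (n k : nat).
Local Notation V := 'rV[R]_n.
Local Notation L := (kvec R n k).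

(* a formal sum of k-elements (p; a) is encoded as the finitely supported map
   sending p to the k-vector attached to p *)
Definition csupp (A : V -> L) : set V := [set p | A p != 0].

Definition kelem (p : V) (a : L) : V -> L := fun q => if q == p then a else 0.

(* T_u (p; a) = (p + u; a) *)
Definition translate (u : V) (A : V -> L) : V -> L := fun q => A (q - u).

(* sigma = u_1 o .. o u_j is given by the sequence of its factors; the order of
   the factors is irrelevant since translations commute *)
Definition difference (sigma : seq V) (p : V) (a : L) : V -> L :=
  foldr (fun u A => translate u A - A) (kelem p a) sigma.

Definition sigma_norm (sigma : seq V) : R := \prod_(u <- sigma) enorm u.

Definition convex_hull (S : set V) : set V :=
  [set p | forall C : set V, convex_set C -> S `<=` C -> C p].

Definition inside (U : set V) (A : V -> L) : Prop := convex_hull (csupp A) `<=` U.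

Definition chain_pred (U : set V) : {pred V -> L} :=
  fun A => `[< finite_set (csupp A) /\ csupp A `<=` U >].

Fact chain_submod_closed U : submod_closed (chain_pred U).
Proof.
split.
  have s0 : csupp 0 = set0.
    by apply/seteqP; split => // p; rewrite /csupp /= eqxx.
  by apply/asboolP; rewrite s0; split; [exact: finite_set0|exact: sub0set].
move=> c A B /asboolP[fA AU] /asboolP[fB BU]; apply/asboolP.
have sub : csupp (c *: A + B) `<=` csupp A `|` csupp B.
  move=> p; rewrite /csupp /= => AB.
  have [Ap|] := eqVneq (A p) 0; last by left.
  right; apply: contra AB => /eqP Bp.
  by rewrite [_ p](_ : _ = c *: A p + B p)// Ap Bp scaler0 addr0.
split; first by apply: sub_finite_set sub _; rewrite finite_setU; split.
by move=> p /sub [/AU|/BU].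
Qed.

HB.instance Definition _ U :=
  GRing.isSubmodClosed.Build R (V -> L) (chain_pred U) (chain_submod_closed U).

Record chain (U : set V) :=
  Chain { chain_val :> V -> L ; chain_valP : chain_val \in chain_pred U }.
HB.instance Definition _ U := [isSub for @chain_val U].
HB.instance Definition _ U := [Choice of chain U by <:].
HB.instance Definition _ U := [SubChoice_isSubLmodule of chain U by <:].

Variable U : set V.

(* a term t = (sigma, p, a) of D stands for Delta_sigma (p; a) *)
Definition is_decomposition (r : nat) (A : chain U) (D : seq (seq V * V * L)) :=
  (forall t, t \in D ->
     (size t.1.1 <= r)%N /\ inside U (difference t.1.1 t.1.2 t.2)) /\
  val A = \sum_(t <- D) difference t.1.1 t.1.2 t.2.

Definition bnorm (r : nat) (A : chain U) : R :=
  inf [set x | exists2 D, is_decomposition r A D &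
                x = \sum_(t <- D) sigma_norm t.1.1 * mass t.2].

Lemma sigma_norm_ge0 sigma : 0 <= sigma_norm sigma.
Proof. by apply: prodr_ge0 => u _; exact: sqrtr_ge0. Qed.

Lemma bnorm_lbound0 r A : lbound [set x | exists2 D, is_decomposition r A D &
  x = \sum_(t <- D) sigma_norm t.1.1 * mass t.2] 0.
Proof.
move=> _ [D _ ->]; apply: sumr_ge0 => t _.
by rewrite mulr_ge0 ?sigma_norm_ge0 ?mass_ge0.
Qed.

Lemma bnorm_le r A D : is_decomposition r A D ->
  bnorm r A <= \sum_(t <- D) sigma_norm t.1.1 * mass t.2.
Proof.
by move=> AD; apply: ge_inf; [exists 0; exact: bnorm_lbound0|exists D].
Qed.

Lemma convex_hull1 p : convex_hull [set p] = [set p].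
Proof.
apply/seteqP; split => [q|q ->]; last by move=> C _; exact.
apply => // x y l; rewrite !inE => -> ->.
by rewrite convmm.
Qed.

Lemma inside_kelem p a : U p -> inside U (kelem p a).
Proof.
move=> Up q /(_ [set p])-> // => [x y l|x]; rewrite ?inE.
  by move=> -> ->; rewrite convmm.
by rewrite /csupp /= /kelem; case: (eqVneq x p); rewrite ?eqxx.
Qed.

Lemma decomposition_exists r A : exists D, is_decomposition r A D.
Proof.
have /asboolP[/finite_seqP[s sE] AU] := valP A.
exists [seq ([::], p, A p) | p <- undup s]; split.
  move=> t /mapP[p ps ->] /=; split => //; apply: inside_kelem.
  by apply: AU; rewrite sE /=; move: ps; rewrite mem_undup.
rewrite big_map /=; apply/funext => q; rewrite fct_sumE.
have [qs|qs] := boolP (q \in undup s).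
  rewrite (bigD1_seq q) ?undup_uniq//= /difference /= /kelem eqxx big1 ?addr0//.
  by move=> p pq; rewrite eq_sym (negbTE pq).
rewrite big_seq big1 => [|p ps]; last first.
  rewrite /difference /= /kelem; case: (eqVneq q p) => // qp.
  by move: qs; rewrite qp ps.
apply/eqP/negPn/negP => Aq; move: qs; rewrite mem_undup.
by have : csupp A q by []; rewrite sE /= => ->.
Qed.

Lemma bnorm_ge0 r A : 0 <= bnorm r A.
Proof.
apply: lb_le_inf; last exact: bnorm_lbound0.
by have [D AD] := decomposition_exists r A; eexists; exists D.
Qed.

Lemma translateZ u c A : translate u (c *: A) = c *: translate u A.
Proof. by []. Qed.

Lemma kelemZ c p a : kelem p (c *: a) = c *: kelem p a.
Proof.
apply/funext => q; rewrite [RHS](_ : _ = c *: kelem p a q)// /kelem.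
by case: ifP; rewrite ?scaler0.
Qed.

Lemma differenceZ c sigma p a :
  difference sigma p (c *: a) = c *: difference sigma p a.
Proof.
elim: sigma => [|u s IH]; first exact: kelemZ.
by rewrite /difference /= -!/(difference s p _) IH translateZ scalerBr.
Qed.

Lemma csuppZ c A : csupp (c *: A) `<=` csupp A.
Proof.
move=> p; rewrite /csupp /=; apply: contra => /eqP Ap.
by rewrite [_ p](_ : _ = c *: A p)// Ap scaler0.
Qed.

Lemma convex_hullS (S S' : set V) : S `<=` S' -> convex_hull S `<=` convex_hull S'.
Proof. by move=> SS' p pS C cC S'C; apply: pS => // q /SS' /S'C. Qed.

Lemma bnormZ_le r c A : bnorm r (c *: A) <= `|c| * bnorm r A.
Proof.
have [->|c0] := eqVneq c 0.
  rewrite scale0r normr0 mul0r (le_trans (@bnorm_le _ _ [::] _)) ?big_nil//.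
  by split => //; rewrite big_nil.
rewrite -ler_pdivrMl ?normr_gt0//; apply: lb_le_inf.
  by have [D AD] := decomposition_exists r A; eexists; exists D.
move=> _ [D [Din AD] ->]; rewrite ler_pdivrMl ?normr_gt0//.
have dD : is_decomposition r (c *: A) [seq (t.1, c *: t.2) | t <- D].
  split=> [_ /mapP[t /Din[? tU] ->]/=|].
    split=> //; rewrite differenceZ.
    exact: subset_trans (convex_hullS (@csuppZ _ _)) tU.
  rewrite /= big_map /= [LHS](_ : _ = c *: val A)// AD scaler_sumr.
  by apply: eq_bigr => t _; rewrite differenceZ.
apply: le_trans (bnorm_le dD) _.
rewrite big_map /= mulr_sumr le_eqVlt; apply/orP; left; apply/eqP.
by apply: eq_bigr => t _; rewrite massZ mulrCA.
Qed.

Lemma bnormZ r c A : bnorm r (c *: A) = `|c| * bnorm r A.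
Proof.
have [->|c0] := eqVneq c 0.
  apply/eqP; rewrite eq_le bnormZ_le normr0 mul0r; exact: bnorm_ge0.
apply/eqP; rewrite eq_le bnormZ_le /= -ler_pdivlMl ?normr_gt0//.
by rewrite -normfV -{1}(scalerK c0 A) bnormZ_le.
Qed.

Lemma bnorm_triangle r A B : bnorm r (A + B) <= bnorm r A + bnorm r B.
Proof.
rewrite -lerBlDr; apply: lb_le_inf.
  by have [D AD] := decomposition_exists r A; eexists; exists D.
move=> _ [D [Din AD] ->]; rewrite lerBlDr -lerBlDl; apply: lb_le_inf.
  by have [E BE] := decomposition_exists r B; eexists; exists E.
move=> _ [E [Ein BE] ->]; rewrite lerBlDl -big_cat; apply: bnorm_le; split.
  by move=> t; rewrite mem_cat => /orP[/Din|/Ein].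
by rewrite big_cat /= -AD -BE.
Qed.

Lemma bnorm_mono r s A : (r <= s)%N -> bnorm s A <= bnorm r A.
Proof.
move=> rs; apply: lb_le_inf.
  by have [D AD] := decomposition_exists r A; eexists; exists D.
move=> _ [D [Din AD] ->]; apply: bnorm_le; split => // t /Din[tr tU].
by split => //; exact: leq_trans rs.
Qed.

End dirac_chains.

Section neighborhood_base.
Variables (R : realType) (E : lmodType R) (nbase : set_system E).

Definition lc_open : set_system E :=
  [set A | forall x, A x -> exists2 W, nbase W & forall w, W w -> A (x + w)].

Hypothesis nbaseZ : forall (c : R) W, nbase W ->
  exists2 X, nbase X & forall x, X x -> W (c *: x).
Hypothesis nbase_absconvex : forall W, nbase W -> forall (a b : R) x y,
  W x -> W y -> `|a| + `|b| <= 1 -> W (a *: x + b *: y).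
Hypothesis nbase_absorbing : forall W, nbase W -> forall x,
  exists2 e : R, 0 < e & forall a, `|a| < e -> W (a *: x).

Lemma nbase0 W : nbase W -> W 0.
Proof.
move=> /nbase_absorbing/(_ 0)[e e0 /(_ 0)]; rewrite scale0r; apply.
by rewrite normr0.
Qed.

Definition lc_interior (A : set E) :=
  [set x | exists2 W, nbase W & forall w, W w -> A (x + w)].

Lemma lc_interior_sub A : lc_interior A `<=` A.
Proof. by move=> x [W /nbase0 W0 /(_ _ W0)]; rewrite addr0. Qed.

Lemma lc_interior_open A : lc_open (lc_interior A).
Proof.
move=> x [W Wb WA]; have [X Xb XW] := nbaseZ 2 Wb.
exists X => // w Xw; exists X => // v Xv; rewrite -addrA; apply: WA.
rewrite (_ : w + v = 2^-1 *: (2 *: w) + 2^-1 *: (2 *: v)); last first.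
  by rewrite !scalerA mulVf// !scale1r.
apply: nbase_absconvex => //; [exact: XW|exact: XW|].
by rewrite ger0_norm ?invr_ge0//; lra.
Qed.

Lemma lc_nbhs_of_openP (x : E) (A : set E) : nbhs_of_open lc_open x A <->
  exists2 W, nbase W & forall w, W w -> A (x + w).
Proof.
split=> [[B [oB Bx BA]]|xA].
  by have [W Wb WB] := oB x Bx; exists W => // w /WB/BA.
exists (lc_interior A); split => //; first exact: lc_interior_open.
exact: lc_interior_sub.
Qed.

End neighborhood_base.

(* the locally convex topology with a given base of absolutely convex
   neighborhoods of 0 *)
HB.factory Record Lmodule_isLocallyConvex (R : realType) E
    & GRing.Lmodule R E := {
  nbase : set_system E ;
  nbase_nonempty : nbase !=set0 ;
  nbaseI : forall W X, nbase W -> nbase X ->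
    exists2 Y, nbase Y & Y `<=` W `&` X ;
  nbaseZ : forall (c : R) W, nbase W ->
    exists2 X, nbase X & forall x, X x -> W (c *: x) ;
  nbase_absconvex : forall W, nbase W -> forall (a b : R) x y,
    W x -> W y -> `|a| + `|b| <= 1 -> W (a *: x + b *: y) ;
  nbase_absorbing : forall W, nbase W -> forall x,
    exists2 e : R, 0 < e & forall a, `|a| < e -> W (a *: x)
}.

HB.builders Context R E & Lmodule_isLocallyConvex R E.

Local Notation lc_open := (@lc_open R E nbase).
Local Notation lc_interior := (@lc_interior R E nbase).

Let nbase0 := nbase0 nbase_absorbing.
Let lc_interior_sub := lc_interior_sub nbase_absorbing.
Let lc_interior_open := lc_interior_open nbaseZ nbase_absconvex.

Let lc_openT : lc_open setT.
Proof. by move=> x _; have [W] := nbase_nonempty; exists W. Qed.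

Let lc_openI : setI_closed lc_open.
Proof.
move=> A B oA oB x [/oA[W Wb WA] /oB[X Xb XB]].
have [Y Yb YWX] := nbaseI Wb Xb; exists Y => // w /YWX[Ww Xw].
by split; [exact: WA|exact: XB].
Qed.

Let lc_open_bigU (I : Type) (f : I -> set E) :
  (forall i, lc_open (f i)) -> lc_open (\bigcup_i f i).
Proof.
move=> of_ x [i _ /of_[W Wb Wf]]; exists W => // w /Wf fw.
by exists i.
Qed.

HB.instance Definition _ :=
  isOpenTopological.Build E lc_openT lc_openI lc_open_bigU.

Let lc_nbhsP (x : E) (A : set E) :
  nbhs x A <-> exists2 W, nbase W & forall w, W w -> A (x + w).
Proof. exact: (lc_nbhs_of_openP nbaseZ nbase_absconvex nbase_absorbing). Qed.

Let lc_add_continuous : continuous (fun x : E * E => x.1 + x.2).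
Proof.
move=> [x y] A /= /lc_nbhsP[W Wb WA]; have [X Xb XW] := nbaseZ 2 Wb.
exists ([set x + w | w in X], [set y + w | w in X]).
  by split; apply/lc_nbhsP; exists X => // w Xw; exists w.
move=> [_ _] /= [[w Xw <-] [v Xv <-]]; rewrite addrACA; apply: WA.
rewrite (_ : w + v = 2^-1 *: (2 *: w) + 2^-1 *: (2 *: v)); last first.
  by rewrite !scalerA mulVf// !scale1r.
apply: nbase_absconvex => //; [exact: XW|exact: XW|].
by rewrite ger0_norm ?invr_ge0//; lra.
Qed.

Let lc_scale_continuous : continuous (fun z : R^o * E => z.1 *: z.2).
Proof.
move=> [c x] A /= /lc_nbhsP[W Wb WA]; have [X Xb XW] := nbaseZ 2 Wb.
have [e e0 Xe] := nbase_absorbing Xb x.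
have [Y Yb YX] := nbaseZ (`|c| + e) Xb.
exists (ball (c : R^o) e, [set x + w | w in Y]).
  split; first exact: nbhsx_ballx.
  by apply/lc_nbhsP; exists Y => // w Yw; exists w.
move=> [d _] /= [cd [w Yw <-]].
have de : `|d - c| < e by move: cd; rewrite -ball_normE /= distrC.
have -> : d *: (x + w) = c *: x + ((d - c) *: x + d *: w).
  by rewrite scalerDr addrA -scalerDl (addrC c) subrK.
apply: WA.
rewrite (_ : (d - c) *: x + d *: w =
   2^-1 *: (2 *: ((d - c) *: x)) + 2^-1 *: (2 *: (d *: w))); last first.
  by rewrite !(scalerA 2^-1) mulVf// !scale1r.
apply: nbase_absconvex => //; [by apply: XW; exact: Xe|apply: XW|].
  have ce0 : 0 < `|c| + e by rewrite ltr_wpDl.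
  rewrite (_ : d *: w = (d / (`|c| + e)) *: ((`|c| + e) *: w) + 0 *: 0); last first.
    by rewrite scaler0 addr0 scalerA divfK// gt_eqF.
  apply: nbase_absconvex => //; [exact: YX|exact: nbase0|].
  rewrite normr0 addr0 normrM normfV (gtr0_norm ce0) ler_pdivrMr// mul1r.
  by rewrite -(subrK c d) addrC (le_trans (ler_normD _ _))// lerD2l ltW.
by rewrite ger0_norm ?invr_ge0//; lra.
Qed.

Let lc_locally_convex : exists2 B : set_system E,
  (forall b, b \in B -> convex_set b) & basis B.
Proof.
exists [set A | open A /\ convex_set A]; first by move=> b; rewrite inE => -[].
split; first by move=> A [].
move=> x A /lc_nbhsP[W Wb WA].
exists [set x + w | w in lc_interior W]; last first.
  by move=> _ [w /lc_interior_sub/WA ? <-].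
split; last by exists 0; rewrite ?addr0//; exists W => // w; rewrite add0r.
split.
  have : lc_open [set x + w | w in lc_interior W].
    move=> _ [w /lc_interior_open[X Xb XW] <-]; exists X => // v Xv.
    by exists (w + v); rewrite ?addrA//; exact: XW.
  exact.
move=> _ _ l /[!inE] -[u [X Xb XW] <-] [v [Y Yb YW] <-].
have l0 : 0 <= l%:num by []. have l1 : l%:num <= 1 by [].
have l1E : l%:num + (1 - l%:num) = 1 :> R by rewrite addrC subrK.
exists (l%:num *: u + (1 - l%:num) *: v).
  have [Z Zb ZXY] := nbaseI Xb Yb; exists Z => // w /ZXY[Xw Yw].
  rewrite (_ : _ + w = l%:num *: (u + w) + (1 - l%:num) *: (v + w)).
    apply: nbase_absconvex => //; [exact: XW|exact: YW|].
    by rewrite ger0_norm// ger0_norm ?subr_ge0// l1E.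
  by rewrite !scalerDr addrACA -scalerDl l1E scale1r.
rewrite [RHS](_ : _ = l%:num *: (x + u) + (1 - l%:num) *: (x + v))//.
by rewrite !scalerDr addrACA -scalerDl l1E scale1r.
Qed.

HB.instance Definition _ :=
  PreTopologicalNmodule_isTopologicalNmodule.Build E lc_add_continuous.
HB.instance Definition _ :=
  TopologicalNmodule_isTopologicalLmodule.Build R E lc_scale_continuous.
HB.instance Definition _ := PreTopologicalLmod_isTvs.Build R E
  lc_add_continuous lc_scale_continuous lc_locally_convex.
HB.instance Definition _ := Uniform_isTvs.Build R E lc_locally_convex.

HB.end.

Section completion.
Variables (R : realType) (V : lmodType R).

Record seminorm := Seminorm {
  seminorm_val :> V -> R ;
  seminormD : forall x y, seminorm_val (x + y) <= seminorm_val x + seminorm_val y ;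
  seminormZ : forall c x, seminorm_val (c *: x) = `|c| * seminorm_val x }.

Section seminorm_theory.
Variable N : seminorm.

Lemma seminorm0 : N 0 = 0.
Proof. by rewrite -(scale0r 0) seminormZ normr0 mul0r. Qed.

Lemma seminormN x : N (- x) = N x.
Proof. by rewrite -scaleN1r seminormZ normrN1 mul1r. Qed.

Lemma seminormB x y : N (x - y) = N (y - x).
Proof. by rewrite -seminormN opprB. Qed.

Lemma seminorm_ge0 x : 0 <= N x.
Proof.
have := seminormD N x (- x); rewrite subrr seminorm0 seminormN.
by rewrite -mulr2n pmulrn_lge0.
Qed.

Lemma seminorm_dist x y : `|N x - N y| <= N (x - y).
Proof.
rewrite ler_norml; apply/andP; split.
  rewrite lerNl opprB lerBlDr seminormB.
  by have := seminormD N (y - x) x; rewrite subrK.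
by rewrite lerBlDr; have := seminormD N (x - y) y; rewrite subrK.
Qed.

End seminorm_theory.

Variable N : seminorm.

Definition cauchy_pred : {pred nat -> V} := fun x => `[< forall e, 0 < e ->
  exists m, forall i j, (m <= i)%N -> (m <= j)%N -> N (x i - x j) < e >].

Fact cauchy_submod_closed : submod_closed cauchy_pred.
Proof.
split.
  by apply/asboolP => e e0; exists 0%N => i j _ _; rewrite subrr seminorm0.
move=> c x y /asboolP cx /asboolP cy; apply/asboolP => e e0.
have c0 : 0 < `|c| + 1 by rewrite ltr_wpDl.
have [m xm] := cx (e / 2 / (`|c| + 1)) (divr_gt0 (divr_gt0 e0 (ltr0n _ 2)) c0).
have [p yp] := cy (e / 2) (divr_gt0 e0 (ltr0n _ 2)).
exists (maxn m p) => i j; rewrite !geq_max => /andP[mi pi] /andP[mj pj].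
rewrite (_ : (c *: x + y) i - (c *: x + y) j =
             c *: (x i - x j) + (y i - y j)); last first.
  by rewrite scalerBr opprD addrACA.
rewrite (le_lt_trans (seminormD _ _ _))// seminormZ [ltRHS]splitr.
rewrite ler_ltD ?yp//.
have := xm _ _ mi mj; rewrite ltr_pdivlMr// => /ltW; apply: le_trans.
by rewrite mulrC ler_wpM2l ?seminorm_ge0// lerDl.
Qed.

HB.instance Definition _ :=
  GRing.isSubmodClosed.Build R (nat -> V) cauchy_pred cauchy_submod_closed.

Record cauchy_sequence :=
  CauchySequence { cs_val :> nat -> V ; cs_valP : cs_val \in cauchy_pred }.
HB.instance Definition _ := [isSub for cs_val].
HB.instance Definition _ := [Choice of cauchy_sequence by <:].
HB.instance Definition _ := [SubChoice_isSubLmodule of cauchy_sequence by <:].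

Lemma is_cvg_seminorm (x : cauchy_sequence) : cvgn (fun i => N (x i)).
Proof.
apply/cauchy_cvgP/cauchy_exP => e e0.
have /asboolP/(_ e e0)[m xm] := cs_valP x.
exists (N (x m)); exists m => // i /= mi.
by rewrite -ball_normE /= (le_lt_trans (seminorm_dist _ _ _))// xm.
Qed.

Definition seminorm_lim (x : cauchy_sequence) : R := limn (fun i => N (x i)).

Lemma seminorm_limD x y : seminorm_lim (x + y) <= seminorm_lim x + seminorm_lim y.
Proof.
rewrite /seminorm_lim -limD; [|exact: is_cvg_seminorm..].
apply: ler_lim; [exact: is_cvg_seminorm|by apply: is_cvgD; exact: is_cvg_seminorm|].
by near=> i; exact: seminormD.
Unshelve. all: by end_near. Qed.

Lemma seminorm_limZ c x : seminorm_lim (c *: x) = `|c| * seminorm_lim x.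
Proof.
rewrite /seminorm_lim (_ : (fun i => N _) = (fun i => `|c| * N (x i))).
  by apply: cvg_lim => //; apply: cvgMl_tmp; exact: is_cvg_seminorm.
by apply/funext => i; exact: seminormZ.
Qed.

Definition null_pred : {pred cauchy_sequence} := fun x => seminorm_lim x == 0.

Lemma seminorm_lim_ge0 x : 0 <= seminorm_lim x.
Proof.
by apply: limr_ge; [exact: is_cvg_seminorm|near=> i; exact: seminorm_ge0].
Unshelve. all: by end_near. Qed.

Fact null_submod_closed : submod_closed null_pred.
Proof.
split.
  by rewrite unfold_in -(scale0r 0) seminorm_limZ normr0 mul0r.
move=> c x y /eqP x0 /eqP y0; rewrite unfold_in /null_pred.
rewrite eq_le seminorm_lim_ge0 andbT (le_trans (seminorm_limD _ _))//.
by rewrite seminorm_limZ x0 y0 mulr0 addr0.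
Qed.

HB.instance Definition _ :=
  GRing.isSubmodClosed.Build R cauchy_sequence null_pred null_submod_closed.


Definition completion := Quotient.quot null_pred.
HB.instance Definition _ := GRing.Zmodule.on completion.
HB.instance Definition _ : EqQuotient cauchy_sequence _ completion :=
  EqQuotient.on completion.

Definition completion_class (x : cauchy_sequence) : completion := \pi x.

Lemma completion_classD x y :
  completion_class (x + y) = completion_class x + completion_class y.
Proof. exact: Quotient.pi_add. Qed.

Lemma completion_classP a : exists x, a = completion_class x.
Proof. by exists (repr a); rewrite /completion_class reprK. Qed.

Lemma completion_class_eq x y :
  completion_class x = completion_class y <-> seminorm_lim (x - y) = 0.
Proof.
split=> [/eqP|xy]; last apply/eqP.
  by rewrite /completion_class -Quotient.idealrBE => /eqP.
by rewrite /completion_class -Quotient.idealrBE; apply/eqP.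
Qed.

Definition completion_scale (c : R) (a : completion) : completion :=
  completion_class (c *: repr a).

Lemma completion_classZ c x :
  completion_scale c (completion_class x) = completion_class (c *: x).
Proof.
apply/completion_class_eq; rewrite -scalerBr seminorm_limZ.
have /completion_class_eq -> : completion_class (repr (completion_class x)) =
  completion_class x by rewrite /completion_class reprK.
by rewrite mulr0.
Qed.

Fact completion_scaleA c d a :
  completion_scale c (completion_scale d a) = completion_scale (c * d) a.
Proof.
by have [x ->] := completion_classP a; rewrite !completion_classZ scalerA.
Qed.

Fact completion_scale1 : left_id 1 completion_scale.
Proof.
by move=> a; have [x ->] := completion_classP a; rewrite completion_classZ scale1r.
Qed.

Fact completion_scaleDr : right_distributive completion_scale +%R.
Proof.
move=> c a b; have [x ->] := completion_classP a.
have [y ->] := completion_classP b.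
by rewrite -completion_classD !completion_classZ scalerDr completion_classD.
Qed.

Fact completion_scaleDl a : {morph completion_scale^~ a : c d / c + d}.
Proof.
move=> c d; have [x ->] := completion_classP a.
by rewrite !completion_classZ scalerDl completion_classD.
Qed.

HB.instance Definition _ := GRing.Zmodule_isLmodule.Build R completion
  completion_scaleA completion_scale1 completion_scaleDr completion_scaleDl.

Fact completion_class_is_linear : linear completion_class.
Proof. by move=> c x y; rewrite completion_classD -completion_classZ. Qed.
HB.instance Definition _ := GRing.isLinear.Build R cauchy_sequence completion _
  completion_class completion_class_is_linear.

Definition completion_norm (a : completion) : R := seminorm_lim (repr a).

Lemma completion_norm_class x : completion_norm (completion_class x) = seminorm_lim x.
Proof.
have le y z : completion_class y = completion_class z ->
    seminorm_lim y <= seminorm_lim z.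
  move=> /completion_class_eq yz; rewrite -[y](subrK z).
  by rewrite (le_trans (seminorm_limD _ _))// yz add0r.
apply/eqP; rewrite eq_le /completion_norm; apply/andP.
by split; apply: le; rewrite /completion_class reprK.
Qed.

Fact completion_normD a b :
  completion_norm (a + b) <= completion_norm a + completion_norm b.
Proof.
have [x ->] := completion_classP a; have [y ->] := completion_classP b.
by rewrite -completion_classD !completion_norm_class seminorm_limD.
Qed.

Fact completion_normZ c a : completion_norm (c *: a) = `|c| * completion_norm a.
Proof.
have [x ->] := completion_classP a.
by rewrite -linearZ !completion_norm_class seminorm_limZ.
Qed.

Fact completion_norm_eq0 a : completion_norm a = 0 -> a = 0.
Proof.
have [x ->] := completion_classP a; rewrite completion_norm_class => x0.
by rewrite -[RHS](linear0 completion_class); apply/completion_class_eq; rewrite subr0.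
Qed.

HB.instance Definition _ := Lmodule_isNormed.Build R completion
  completion_normD completion_normZ completion_norm_eq0.

Fact cst_cauchy (v : V) : (fun=> v) \in cauchy_pred.
Proof.
by apply/asboolP => e e0; exists 0%N => i j _ _; rewrite subrr seminorm0.
Qed.

Definition to_completion (v : V) : completion :=
  completion_class (CauchySequence (cst_cauchy v)).

Lemma norm_to_completion v : `|to_completion v| = N v.
Proof.
rewrite [LHS]completion_norm_class /seminorm_lim /=.
exact: lim_cst.
Qed.

Fact to_completion_is_linear : linear to_completion.
Proof.
move=> c v w; rewrite /to_completion -linearP; congr completion_class.
exact/val_inj.
Qed.
HB.instance Definition _ := GRing.isLinear.Build R V completion _
  to_completion to_completion_is_linear.

End completion.

Section completion_map.
Variables (R : realType) (V : lmodType R).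
Implicit Types N M : seminorm V.

Fact cauchy_widen N M : (forall v, M v <= N v) ->
  forall x : cauchy_sequence N, (x : nat -> V) \in cauchy_pred M.
Proof.
move=> MN x; apply/asboolP => e e0.
have /asboolP/(_ e e0)[m xm] := cs_valP x.
by exists m => i j mi mj; rewrite (le_lt_trans (MN _))// xm.
Qed.

(* the map between completions induced by the identity of V *)
Definition completion_map N M (MN : forall v, M v <= N v) (a : completion N) :
  completion M := completion_class (CauchySequence (cauchy_widen MN (repr a))).

Lemma completion_map_class N M (MN : forall v, M v <= N v) x :
  completion_map MN (completion_class x) =
  completion_class (CauchySequence (cauchy_widen MN x)).
Proof.
have : completion_class (repr (completion_class x)) = completion_class x.
  by rewrite /completion_class reprK.
move=> /completion_class_eq xx; apply/completion_class_eq/eqP.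
rewrite eq_le seminorm_lim_ge0 andbT -xx; apply: ler_lim.
- exact: is_cvg_seminorm.
- exact: is_cvg_seminorm.
- by near=> i; exact: MN.
Unshelve. all: by end_near. Qed.

Fact completion_map_is_linear N M (MN : forall v, M v <= N v) :
  linear (completion_map MN).
Proof.
move=> c a b; have [x ->] := completion_classP a.
have [y ->] := completion_classP b.
rewrite -linearP !completion_map_class -linearP; congr completion_class.
exact/val_inj.
Qed.
HB.instance Definition _ N M (MN : forall v, M v <= N v) :=
  GRing.isLinear.Build R (completion N) (completion M) _
    (completion_map MN) (completion_map_is_linear MN).

End completion_map.

(* direct systems of normed spaces indexed by nat, with linear linking maps *)
Record direct_system (R : realType) := DirectSystem {
  ds_obj :> nat -> normedModType R ;
  ds_link : forall r s, (r <= s)%N -> {linear ds_obj r -> ds_obj s} ;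
  ds_link_id : forall r (rr : (r <= r)%N) x, ds_link rr x = x ;
  ds_link_comp : forall r s t (rs : (r <= s)%N) (st : (s <= t)%N)
    (rt : (r <= t)%N) x, ds_link st (ds_link rs x) = ds_link rt x }.

Section inductive_limit.
Variables (R : realType) (D : direct_system R).
Local Notation link := (@ds_link R D _ _).

Definition ind_pre := {r : nat & D r}.
HB.instance Definition _ := Choice.on ind_pre.

Definition ind_equiv (x y : ind_pre) : bool :=
  `[< exists m (xm : (tag x <= m)%N) (ym : (tag y <= m)%N),
      link xm (tagged x) = link ym (tagged y) >].

Fact ind_equiv_is_equiv : equiv_class_of ind_equiv.
Proof.
split=> [x|x y|y x z].
- by apply/asboolP; exists (tag x), (leqnn _), (leqnn _).
- by apply/asboolP/asboolP => -[m [xm [ym e]]]; exists m, ym, xm.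
- move=> /asboolP[m [xm [ym e]]] /asboolP[p [yp [zp e']]]; apply/asboolP.
  have mq : (m <= maxn m p)%N by exact: leq_maxl.
  have pq : (p <= maxn m p)%N by exact: leq_maxr.
  exists (maxn m p), (leq_trans xm mq), (leq_trans zp pq).
  rewrite -(ds_link_comp xm mq) e (ds_link_comp _ _ (leq_trans ym mq)).
  by rewrite -(ds_link_comp zp pq) -e' (ds_link_comp _ _ (leq_trans ym mq)).
Qed.

Canonical ind_equiv_equiv := EquivRelPack ind_equiv_is_equiv.
Canonical ind_equiv_encModRel := defaultEncModRel ind_equiv.

Definition ind_lim := {eq_quot ind_equiv}.
HB.instance Definition _ := Choice.on ind_lim.
HB.instance Definition _ : EqQuotient ind_pre ind_equiv ind_lim :=
  EqQuotient.on ind_lim.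

Definition ind_inj (r : nat) (x : D r) : ind_lim :=
  \pi_ind_lim (existT (fun r => D r : Type) r x : ind_pre).

Lemma ind_inj_eq r s (x : D r) (y : D s) : ind_inj x = ind_inj y <->
  exists m (rm : (r <= m)%N) (sm : (s <= m)%N), link rm x = link sm y.
Proof.
split=> [/eqP|e]; last apply/eqP.
  by rewrite /ind_inj eqmodE => /asboolP.
by rewrite /ind_inj eqmodE; apply/asboolP.
Qed.

Lemma ind_inj_link r s (rs : (r <= s)%N) x : ind_inj (link rs x) = ind_inj x.
Proof.
apply/ind_inj_eq; exists s, (leqnn s), rs.
by rewrite ds_link_id.
Qed.

Lemma ind_limP (a : ind_lim) : exists r (x : D r), a = ind_inj x.
Proof.
exists (tag (repr a)), (tagged (repr a)).
by rewrite /ind_inj -[LHS]reprK; case: (repr a).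
Qed.

Lemma ind_limP2 (a b : ind_lim) :
  exists r (x y : D r), a = ind_inj x /\ b = ind_inj y.
Proof.
have [r [x ->]] := ind_limP a; have [s [y ->]] := ind_limP b.
exists (maxn r s), (link (leq_maxl r s) x), (link (leq_maxr r s) y).
by rewrite !ind_inj_link.
Qed.

Lemma ind_limP3 (a b c : ind_lim) :
  exists r (x y z : D r), [/\ a = ind_inj x, b = ind_inj y & c = ind_inj z].
Proof.
have [r [x [y [-> ->]]]] := ind_limP2 a b; have [s [z ->]] := ind_limP c.
exists (maxn r s), (link (leq_maxl r s) x), (link (leq_maxl r s) y),
  (link (leq_maxr r s) z).
by rewrite !ind_inj_link.
Qed.

Definition ind_add (a b : ind_lim) : ind_lim :=
  let x := repr a in let y := repr b in
  ind_inj (link (leq_maxl (tag x) (tag y)) (tagged x) +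
           link (leq_maxr (tag x) (tag y)) (tagged y)).
Definition ind_zero : ind_lim := ind_inj (0 : D 0%N).
Definition ind_scale (c : R) (a : ind_lim) : ind_lim :=
  ind_inj (c *: tagged (repr a)).
Definition ind_opp (a : ind_lim) : ind_lim := ind_scale (-1) a.

Lemma ind_inj_repr r (x : D r) :
  ind_inj (tagged (repr (ind_inj x))) = ind_inj x.
Proof. by rewrite /ind_inj -[RHS]reprK; case: (repr _). Qed.

Lemma ind_addE r (x y : D r) : ind_add (ind_inj x) (ind_inj y) = ind_inj (x + y).
Proof.
have /ind_inj_eq[m [am [rm ex]]] := ind_inj_repr x.
have /ind_inj_eq[p [bp [rp ey]]] := ind_inj_repr y.
rewrite /ind_add; set a := repr (ind_inj x) in am ex *.
set b := repr (ind_inj y) in bp ey *.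
have mq : (m <= maxn m p)%N by exact: leq_maxl.
have pq : (p <= maxn m p)%N by exact: leq_maxr.
have abq : (maxn (tag a) (tag b) <= maxn m p)%N.
  by rewrite geq_max (leq_trans am mq) (leq_trans bp pq).
have rq := leq_trans rm mq.
apply/ind_inj_eq; exists (maxn m p), abq, rq.
rewrite !linearD (ds_link_comp _ _ (leq_trans am mq)).
rewrite (ds_link_comp _ _ (leq_trans bp pq)).
by rewrite -(ds_link_comp am mq) -(ds_link_comp bp pq) ex ey !(ds_link_comp _ _ rq).
Qed.

Lemma ind_scaleE c r (x : D r) : ind_scale c (ind_inj x) = ind_inj (c *: x).
Proof.
have /ind_inj_eq[m [am [rm ex]]] := ind_inj_repr x.
by apply/ind_inj_eq; exists m, am, rm; rewrite !linearZ /= ex.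
Qed.

Lemma ind_zeroE r : ind_zero = ind_inj (0 : D r).
Proof. by apply/ind_inj_eq; exists r, (leq0n r), (leqnn r); rewrite !linear0. Qed.

Fact ind_addA : associative ind_add.
Proof.
move=> a b c; have [r [x [y [z [-> -> ->]]]]] := ind_limP3 a b c.
by rewrite !ind_addE addrA.
Qed.

Fact ind_addC : commutative ind_add.
Proof.
by move=> a b; have [r [x [y [-> ->]]]] := ind_limP2 a b; rewrite !ind_addE addrC.
Qed.

Fact ind_add0 : left_id ind_zero ind_add.
Proof.
by move=> a; have [r [x ->]] := ind_limP a; rewrite (ind_zeroE r) ind_addE add0r.
Qed.

Fact ind_addN : left_inverse ind_zero ind_opp ind_add.
Proof.
move=> a; have [r [x ->]] := ind_limP a.
by rewrite /ind_opp ind_scaleE ind_addE scaleN1r addNr -ind_zeroE.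
Qed.

HB.instance Definition _ := GRing.isZmodule.Build ind_lim
  ind_addA ind_addC ind_add0 ind_addN.

Fact ind_scaleA c d a : ind_scale c (ind_scale d a) = ind_scale (c * d) a.
Proof. by have [r [x ->]] := ind_limP a; rewrite !ind_scaleE scalerA. Qed.

Fact ind_scale1 : left_id 1 ind_scale.
Proof. by move=> a; have [r [x ->]] := ind_limP a; rewrite ind_scaleE scale1r. Qed.

Fact ind_scaleDr : right_distributive ind_scale +%R.
Proof.
move=> c a b; have [r [x [y [-> ->]]]] := ind_limP2 a b.
by rewrite [_ + _]ind_addE !ind_scaleE [RHS]ind_addE scalerDr.
Qed.

Fact ind_scaleDl a : {morph ind_scale^~ a : c d / c + d}.
Proof.
move=> c d; have [r [x ->]] := ind_limP a.
by rewrite !ind_scaleE [RHS]ind_addE scalerDl.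
Qed.

HB.instance Definition _ := GRing.Zmodule_isLmodule.Build R ind_lim
  ind_scaleA ind_scale1 ind_scaleDr ind_scaleDl.

Fact ind_inj_is_linear r : linear (@ind_inj r).
Proof. by move=> c x y; rewrite -ind_addE -ind_scaleE. Qed.
HB.instance Definition _ r := GRing.isLinear.Build R (D r) ind_lim _
  (@ind_inj r) (@ind_inj_is_linear r).

(* the finest locally convex topology making all the maps ind_inj continuous *)
Definition ind_nbase : set_system ind_lim := [set W |
  (forall (a b : R) x y, W x -> W y -> `|a| + `|b| <= 1 -> W (a *: x + b *: y)) /\
  (forall r, nbhs (0 : D r) (@ind_inj r @^-1` W))].

Fact ind_nbase_nonempty : ind_nbase !=set0.
Proof. by exists setT; split => // r; rewrite preimage_setT; exact: filterT. Qed.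

Fact ind_nbaseI W X : ind_nbase W -> ind_nbase X ->
  exists2 Y, ind_nbase Y & Y `<=` W `&` X.
Proof.
move=> [Wc W0] [Xc X0]; exists (W `&` X) => //; split.
  by move=> a b x y [Wx Xx] [Wy Xy] ab; split; [exact: Wc|exact: Xc].
by move=> r; rewrite preimage_setI; exact: filterI.
Qed.

Fact ind_nbaseZ c W : ind_nbase W ->
  exists2 X, ind_nbase X & forall x, X x -> W (c *: x).
Proof.
move=> [Wc W0]; exists [set x | W (c *: x)] => //; split.
  move=> a b x y /= Wx Wy ab; rewrite scalerDr !scalerA ![c * _]mulrC -!scalerA.
  exact: Wc.
move=> r; have := @scaler_continuous _ (D r) c 0.
rewrite /continuous_at scaler0 => /(_ _ (W0 r)) cW.
suff -> : @ind_inj r @^-1` [set x | W (c *: x)] =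
  ( *:%R c) @^-1` (@ind_inj r @^-1` W) by exact: cW.
by apply/funext => x; rewrite /preimage /= linearZ.
Qed.

Fact ind_nbase_absconvex W : ind_nbase W -> forall (a b : R) x y,
  W x -> W y -> `|a| + `|b| <= 1 -> W (a *: x + b *: y).
Proof. by move=> []. Qed.

Fact ind_nbase_absorbing W : ind_nbase W -> forall x,
  exists2 e : R, 0 < e & forall a, `|a| < e -> W (a *: x).
Proof.
move=> [_ W0] a; have [r [x ->]] := ind_limP a.
have := @scalel_continuous _ (D r) x 0.
rewrite /continuous_at scale0r => /(_ _ (W0 r)).
move=> /nbhs_ballP[e /= e0 eW]; exists e => // c ce.
rewrite -linearZ; apply: eW.
by rewrite -ball_normE /= sub0r normrN.
Qed.

HB.instance Definition _ := Lmodule_isLocallyConvex.Build R ind_lim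
  ind_nbase_nonempty ind_nbaseI ind_nbaseZ ind_nbase_absconvex
  ind_nbase_absorbing.

Lemma ind_nbhsP (a : ind_lim) (A : set ind_lim) :
  nbhs a A <-> exists2 W, ind_nbase W & forall w, W w -> A (a + w).
Proof.
exact: (lc_nbhs_of_openP ind_nbaseZ ind_nbase_absconvex ind_nbase_absorbing).
Qed.

End inductive_limit.

Section forms.
Variables (R : realType) (n k : nat) (U : set 'rV[R]_n).
Local Notation A_U := (chain k U).

Definition unit_differences (j : nat) : set A_U :=
  [set A | exists sigma p a, [/\ size sigma = j, val A = difference sigma p a,
     inside U (difference sigma p a) & sigma_norm sigma * mass a = 1]].

(* the unit 0 makes the supremum over an empty set count as 0 *)
Definition form_norm (r : nat) (omega : A_U -> R^o) : \bar R :=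
  \big[maxe/0%E]_(j < r.+1)
    ereal_sup [set `|omega A|%:E | A in unit_differences j].

Definition form_pred : {pred A_U -> R^o} :=
  fun omega => `[< linear omega /\ forall r, (form_norm r omega < +oo)%E >].

Lemma form_norm_ge0 r omega : (0 <= form_norm r omega)%E.
Proof. exact: bigmax_ge_id. Qed.

Lemma form_norm_leP r omega (x : \bar R) : (0 <= x)%E ->
  (form_norm r omega <= x)%E <->
  forall j A, (j <= r)%N -> unit_differences j A -> (`|omega A|%:E <= x)%E.
Proof.
move=> x0; split=> [/bigmax_leP[_ rx] j A jr jA|rx].
  apply: le_trans (rx (inord j) isT); rewrite inordK//.
  by apply: ereal_sup_ubound; exists A.
apply/bigmax_leP; split => // j _; apply: ge_ereal_sup => _ [A jA <-].
by apply: rx jA; rewrite -ltnS.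
Qed.

Lemma le_form_norm r omega j A : (j <= r)%N -> unit_differences j A ->
  (`|omega A|%:E <= form_norm r omega)%E.
Proof. by move: j A; apply/form_norm_leP => //; exact: form_norm_ge0. Qed.

Lemma form_norm_mono r s omega : (r <= s)%N ->
  (form_norm r omega <= form_norm s omega)%E.
Proof.
move=> rs; apply/form_norm_leP; first exact: form_norm_ge0.
by move=> j A jr jA; apply: (@le_form_norm _ _ j) => //; exact: leq_trans rs.
Qed.

Lemma form_norm_lin r (a b : R) (omega eta : A_U -> R^o) :
  (form_norm r (a *: omega + b *: eta)%R <=
   `|a|%:E * form_norm r omega + `|b|%:E * form_norm r eta)%E.
Proof.
apply/form_norm_leP.
  by rewrite adde_ge0// mule_ge0// ?lee_fin ?form_norm_ge0.
move=> j A jr jA.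
apply: (@le_trans _ _ (`|a|%:E * `|omega A|%:E + `|b|%:E * `|eta A|%:E)%E).
  by rewrite -!EFinM -EFinD lee_fin -!normrM ler_normD.
by rewrite leeD// lee_wpmul2l ?lee_fin// (le_form_norm _ jr jA).
Qed.

Fact form_submod_closed : submod_closed form_pred.
Proof.
split.
  apply/asboolP; split=> [c A B|r]; first by rewrite /= scaler0 addr0.
  apply: (@le_lt_trans _ _ 0%E) => //; apply/form_norm_leP => // j A _ _.
  by rewrite /= normr0.
move=> c omega eta /asboolP[lo fo] /asboolP[le fe]; apply/asboolP; split=> [d A B|r].
  rewrite [LHS](_ : _ = c *: omega (d *: A + B) + eta (d *: A + B))// lo le.
  rewrite scalerDr scalerA [c * d]mulrC -scalerA addrACA -scalerDr.
  by [].
rewrite -[eta]scale1r (le_lt_trans (form_norm_lin _ _ _ _ _))//.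
by rewrite lte_add_pinfty// lte_mul_pinfty.
Qed.

HB.instance Definition _ := GRing.isSubmodClosed.Build R (A_U -> R^o) form_pred
  form_submod_closed.

Record kform :=
  KForm { form_val :> A_U -> R^o ; form_valP : form_val \in form_pred }.
HB.instance Definition _ := [isSub for form_val].
HB.instance Definition _ := [Choice of kform by <:].
HB.instance Definition _ := [SubChoice_isSubLmodule of kform by <:].

Fact form_is_linear (omega : kform) : linear omega.
Proof. by have /asboolP[] := form_valP omega. Qed.
HB.instance Definition _ (omega : kform) :=
  GRing.isLinear.Build R A_U R^o _ omega (form_is_linear omega).

Lemma form_norm_lty r (omega : kform) : (form_norm r omega < +oo)%E.
Proof. by have /asboolP[] := form_valP omega. Qed.

Definition form_nbase : set_system kform := [set W | exists r (e : R),
  0 < e /\ W = [set omega : kform | (form_norm r omega < e%:E)%E]].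

Fact form_nbase_nonempty : form_nbase !=set0.
Proof. by exists [set omega : kform | (form_norm 0 omega < 1%:E)%E], 0%N, 1. Qed.

Fact form_nbaseI W X : form_nbase W -> form_nbase X ->
  exists2 Y, form_nbase Y & Y `<=` W `&` X.
Proof.
move=> [r [e [e0 ->]]] [s [d [d0 ->]]].
exists [set omega : kform | (form_norm (maxn r s) omega < (Num.min e d)%:E)%E].
  by exists (maxn r s), (Num.min e d); rewrite lt_min e0 d0.
move=> omega /= oed; split.
  apply: le_lt_trans (form_norm_mono _ (leq_maxl r s)) (lt_le_trans oed _).
  by rewrite lee_fin ge_min lexx.
apply: le_lt_trans (form_norm_mono _ (leq_maxr r s)) (lt_le_trans oed _).
by rewrite lee_fin ge_min lexx orbT.
Qed.

Lemma form_norm_linE r (a b : R) (omega eta : kform) :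
  (form_norm r (a *: omega + b *: eta : kform)%R <=
   `|a|%:E * form_norm r omega + `|b|%:E * form_norm r eta)%E.
Proof.
rewrite (_ : form_val _ = a *: form_val omega + b *: form_val eta) //.
exact: form_norm_lin.
Qed.

Lemma form_normZ_le r (c : R) (omega : kform) :
  (form_norm r (c *: omega : kform) <= `|c|%:E * form_norm r omega)%E.
Proof.
rewrite (_ : form_val (c *: omega) = c *: form_val omega + 0 *: form_val omega).
  by rewrite (le_trans (form_norm_lin _ _ _ _ _))// normr0 mul0e adde0.
by rewrite scale0r addr0.
Qed.

Lemma form_normE r (omega : kform) :
  form_norm r omega = (fine (form_norm r omega))%:E.
Proof. by rewrite fineK// ge0_fin_numE ?form_norm_ge0 ?form_norm_lty. Qed.

Fact form_nbaseZ c W : form_nbase W ->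
  exists2 X, form_nbase X & forall x, X x -> W (c *: x).
Proof.
move=> [r [e [e0 ->]]]; have c0 : 0 < `|c| + 1 by rewrite ltr_wpDl.
exists [set omega : kform | (form_norm r omega < (e / (`|c| + 1))%:E)%E].
  by exists r, (e / (`|c| + 1)); rewrite divr_gt0.
move=> omega /= oe; apply: le_lt_trans (form_normZ_le _ _ _) _.
move: oe; rewrite form_normE -EFinM !lte_fin ltr_pdivlMr//.
apply: le_lt_trans; rewrite mulrC ler_wpM2l ?lerDl//.
by rewrite fine_ge0// form_norm_ge0.
Qed.

Fact form_nbase_absconvex W : form_nbase W -> forall (a b : R) x y,
  W x -> W y -> `|a| + `|b| <= 1 -> W (a *: x + b *: y).
Proof.
move=> [r [e [e0 ->]]] a b omega eta /= oe he ab.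
apply: le_lt_trans (form_norm_linE _ _ _ _ _) _.
move: oe he; rewrite (form_normE r omega) (form_normE r eta).
rewrite -!EFinM -EFinD !lte_fin => oe he.
have [a0|a0] := eqVneq a 0.
  have [b0|b0] := eqVneq b 0; first by rewrite a0 b0 !normr0 !mul0r addr0.
  rewrite a0 normr0 mul0r add0r.
  apply: (@lt_le_trans _ _ (`|b| * e)); first by rewrite ltr_pM2l ?normr_gt0.
  have b1 : `|b| <= 1 by rewrite (le_trans _ ab)// lerDr.
  by rewrite ler_piMl// ltW.
apply: (@lt_le_trans _ _ (`|a| * e + `|b| * e)).
  by rewrite ltr_leD ?ltr_pM2l ?normr_gt0// ler_wpM2l// ltW.
by rewrite -mulrDl ler_piMl// ltW.
Qed.

Fact form_nbase_absorbing W : form_nbase W -> forall x,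
  exists2 e : R, 0 < e & forall a, `|a| < e -> W (a *: x).
Proof.
move=> [r [e [e0 ->]]] omega; set N := fine (form_norm r omega).
have N0 : 0 <= N by rewrite fine_ge0// form_norm_ge0.
have N1 : 0 < N + 1 by rewrite ltr_wpDl.
exists (e / (N + 1)); first by rewrite divr_gt0.
move=> a; rewrite ltr_pdivlMr// => ae /=.
apply: le_lt_trans (form_normZ_le _ _ _) _.
rewrite form_normE -EFinM lte_fin.
by apply: le_lt_trans ae; rewrite ler_wpM2l// lerDl.
Qed.

(* the topology defined by the seminorms form_norm r *)
HB.instance Definition _ := Lmodule_isLocallyConvex.Build R kform
  form_nbase_nonempty form_nbaseI form_nbaseZ form_nbase_absconvex
  form_nbase_absorbing.

Lemma form_nbhsP (omega : kform) (A : set kform) :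
  nbhs omega A <-> exists2 W, form_nbase W & forall eta, W eta -> A (omega + eta).
Proof.
exact: (lc_nbhs_of_openP form_nbaseZ form_nbase_absconvex form_nbase_absorbing).
Qed.

End forms.

Section differential_chains.
Variables (R : realType) (n k : nat) (U : set 'rV[R]_n).

Definition bnorm_seminorm (r : nat) : seminorm (chain k U) :=
  Seminorm (@bnorm_triangle R n k U r) (@bnormZ R n k U r).

Definition Bhat (r : nat) : normedModType R := completion (bnorm_seminorm r).

Definition Bhat_link (r s : nat) (rs : (r <= s)%N) : {linear Bhat r -> Bhat s} :=
  completion_map (N := bnorm_seminorm r) (M := bnorm_seminorm s)
    (fun A => bnorm_mono A rs).

Fact Bhat_link_id r (rr : (r <= r)%N) x : Bhat_link rr x = x.
Proof.
have [y ->] := completion_classP x; rewrite /= completion_map_class.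
by congr completion_class; exact/val_inj.
Qed.

Fact Bhat_link_comp r s t (rs : (r <= s)%N) (st : (s <= t)%N) (rt : (r <= t)%N) x :
  Bhat_link st (Bhat_link rs x) = Bhat_link rt x.
Proof.
have [y ->] := completion_classP x; rewrite /= !completion_map_class.
by congr completion_class; exact/val_inj.
Qed.

Definition Bsystem : direct_system R :=
  DirectSystem (@Bhat_link_id) (@Bhat_link_comp).

Definition differential_chain : tvsType R := ind_lim Bsystem.

Definition represents (A : nat -> chain k U) (J : differential_chain) : Prop :=
  exists r (x : Bhat r),
    to_completion (bnorm_seminorm r) (A i) @[i --> \oo] --> x /\
    J = @ind_inj R Bsystem r x.

(* the value is the same for all sequences of Dirac chains representing J *)
Definition chain_integral (J : differential_chain) (omega : kform k U) : R :=
  xget 0 [set l | exists2 A, represents A J & omega (A i) @[i --> \oo] --> l].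

End differential_chains.

Definition has_time_derivative (R : realType) (E : tvsType R)
    (f : R -> E) (t : R) (df : E) : Prop :=
  h^-1 *: (f (t + h) - f t) @[h --> 0^'] --> df.

(* Main.v *)
Require Import Defs.
From mathcomp Require Import all_boot all_order all_algebra.
From mathcomp Require Import all_classical all_reals all_analysis.
From mathcomp Require Import ring.
Import Order.TTheory GRing.Theory Num.Theory.
Import numFieldNormedType.Exports.
Local Open Scope classical_set_scope.
Local Open Scope ring_scope.

(** The integral is bilinear in the chain and the form, so, with
    D_h = (J_{t+h} - J_t)/h and Q_h = (w_{t+h} - w_t)/h, the difference quotient
    of t |-> int_{J_t} w_t is
      int_{D_h} w_{t+h} + int_{J_t} Q_h.
    The second term tends to int_{J_t} w'_t because a fixed chain lives in one
    of the Banach spaces of the inductive system, on which the integral is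
    bounded by a single seminorm of the form ([chain_integral_le]).

    The first term is the delicate one: both arguments move, and the pairing of
    an inductive limit with a Frechet space is only separately continuous in
    general.  What saves the limit is that it can be tested along sequences
    h_i -> 0.  The forms w_{t+h_i} then make up a convergent sequence, hence a
    bounded set, with a bound in each of the countably many seminorms.  The
    chains on which all of them integrate to at most e in absolute value form an
    absolutely convex set that contains a ball in every step of the inductive
    system, i.e. a neighborhood of 0 in the inductive limit topology
    ([chain_integral_equicontinuous]).  So the integrals over D_{h_i} - J'_t
    tend to 0 uniformly on the sequence of forms, and those over J'_t converge
    by continuity in the form ([cvg_chain_integral_seq]).

    All this rests on the estimate |w A| <= ||w||_{B^r} ||A||_{B^r} for Dirac
    chains ([form_le]), which also shows that the integral does not depend on
    the Dirac chains used to represent J. *)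

Set Implicit Arguments.
Unset Strict Implicit.
Unset Printing Implicit Defensive.

(** * Forms are bounded by the norms of Dirac chains *)

Section difference_chains.
Variables (R : realType) (n k : nat) (U : set 'rV[R]_n).
Implicit Types (sigma : seq 'rV[R]_n) (p : 'rV[R]_n) (a : kvec R n k).

Lemma sub_convex_hull (S : set 'rV[R]_n) : S `<=` convex_hull S.
Proof. by move=> p Sp C _; exact. Qed.

Lemma finite_csupp_difference sigma p a :
  finite_set (csupp (difference sigma p a)).
Proof.
elim: sigma => [|u s IH].
  apply: (@sub_finite_set _ _ [set p]); last exact: finite_set1.
  move=> q; rewrite /csupp /difference /= /kelem.
  by case: (eqVneq q p); rewrite ?eqxx.
apply: (@sub_finite_set _ _ ([set q + u | q in csupp (difference s p a)] `|`
   csupp (difference s p a))); last first.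
  by rewrite finite_setU; split => //; exact: finite_image.
move=> q; rewrite {1}/csupp /= -/(difference s p a) => Aq.
have [q0|] := eqVneq (difference s p a q) 0; last by right.
left; exists (q - u); last by rewrite subrK.
rewrite /csupp /=; apply: contra Aq => /eqP Aqu.
rewrite [_ q](_ : _ = difference s p a (q - u) - difference s p a q)//.
by rewrite Aqu q0 subrr.
Qed.

Lemma difference_chain sigma p a : inside U (difference sigma p a) ->
  exists B : chain k U, val B = difference sigma p a.
Proof.
move=> iU; suff dU : difference sigma p a \in chain_pred U by exists (Chain dU).
apply/asboolP; split; first exact: finite_csupp_difference.
by move=> q /sub_convex_hull/iU.
Qed.

Lemma enorm_eq0 (u : 'rV[R]_n) : enorm u = 0 -> u = 0.
Proof.
move=> /eqP; rewrite sqrtr_eq0 => u0.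
have : \sum_j u ord0 j ^+ 2 == 0.
  by rewrite eq_le u0 sumr_ge0// => j _; exact: sqr_ge0.
rewrite psumr_eq0 => [/allP uP|j _]; last exact: sqr_ge0.
apply/rowP => j; rewrite mxE; apply/eqP.
by have := uP j (mem_index_enum j); rewrite sqrf_eq0.
Qed.

(** The supremum defining the norm of a form only sees differences with
    [sigma_norm sigma * mass a = 1]; the remaining ones cannot be rescaled to
    that value, and this lemma disposes of them. *)
Lemma difference_eq0 sigma p a : sigma_norm sigma * mass a = 0 ->
  difference sigma p a = 0.
Proof.
move=> /eqP; rewrite mulf_eq0 => /orP[|/eqP/mass_eq0 ->]; last first.
  by rewrite -(scale0r (0 : kvec R n k)) differenceZ scale0r.
elim: sigma => [|u s IH]; first by rewrite /sigma_norm big_nil oner_eq0.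
rewrite /sigma_norm big_cons mulf_eq0 /difference /= -/(difference s p a).
move=> /orP[/eqP/enorm_eq0 ->|/IH ->].
  by apply/funext => q; rewrite [LHS](_ : _ = difference s p a (q - 0) -
    difference s p a q)// subr0 subrr.
by apply/funext => q; rewrite [LHS](_ : _ = 0 - 0 :> kvec R n k)// subr0.
Qed.

Definition form_seminorm (r : nat) (w : kform k U) : R := fine (form_norm r w).

Lemma form_seminorm_ge0 r w : 0 <= form_seminorm r w.
Proof. by rewrite fine_ge0// form_norm_ge0. Qed.

Lemma form_difference_le (w : kform k U) r (B : chain k U) sigma p a :
  (size sigma <= r)%N -> inside U (difference sigma p a) ->
  val B = difference sigma p a ->
  `|w B : R| <= form_seminorm r w * (sigma_norm sigma * mass a).
Proof.
move=> sr iU BE; set c := sigma_norm sigma * mass a.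
have [c0|c0] := eqVneq c 0.
  have -> : B = 0 by apply/val_inj; rewrite BE difference_eq0.
  by rewrite linear0 normr0 c0 mulr0.
have cp : 0 < c by rewrite lt0r c0 mulr_ge0 ?sigma_norm_ge0 ?mass_ge0.
have uB : unit_differences (size sigma) (c^-1 *: B).
  exists sigma, p, (c^-1 *: a); split => //.
  - by rewrite differenceZ -BE.
  - rewrite differenceZ; apply: subset_trans iU.
    exact: convex_hullS (@csuppZ _ _ _ _ _).
  - by rewrite massZ gtr0_norm ?invr_gt0// mulrCA mulVf.
have := le_form_norm w sr uB.
rewrite form_normE lee_fin linearZ /= normrM normfV (gtr0_norm cp).
by rewrite mulrC ler_pdivrMr.
Qed.

(** Apply [w] to a decomposition of [A] term by term and take the infimum over
    all decompositions. *)
Lemma form_le (w : kform k U) r (A : chain k U) :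
  `|w A : R| <= form_seminorm r w * bnorm r A.
Proof.
have key D : forall A, is_decomposition r A D ->
    `|w A : R| <= form_seminorm r w * \sum_(t <- D) sigma_norm t.1.1 * mass t.2.
  elim: D => [|t D IH] {}A [Din AE].
    have -> : A = 0 by apply/val_inj; rewrite AE big_nil.
    by rewrite linear0 normr0 big_nil mulr0.
  have [ts tU] := Din t (mem_head _ _).
  have [B BE] := difference_chain tU.
  rewrite big_cons mulrDr -[A](subrK B) addrC linearD.
  apply: le_trans (ler_normD _ _) _; apply: lerD.
    exact: form_difference_le BE.
  apply: IH; split=> [s sD|]; first by apply: Din; rewrite inE sD orbT.
  by rewrite [LHS](_ : _ = val A - val B)// AE BE big_cons addrC addKr.
have [F0|F0] := eqVneq (form_seminorm r w) 0.
  have [D /key] := decomposition_exists r A.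
  by rewrite F0 !mul0r.
have Fp : 0 < form_seminorm r w by rewrite lt0r F0 form_seminorm_ge0.
rewrite mulrC -ler_pdivrMr//; apply: lb_le_inf.
  by have [D AD] := decomposition_exists r A; eexists; exists D.
by move=> _ [D /key + ->]; rewrite mulrC -ler_pdivrMr.
Qed.

End difference_chains.

(** * Completions *)

Section completions.
Variables (R : realType) (V : lmodType R).
Implicit Types N M : seminorm V.

(** The norm of [completion_class x - to_completion N (x i)] is the limit over j
    of [N (x j - x i)], small for large i since [x] is Cauchy. *)
Lemma cvg_to_completion N (x : cauchy_sequence N) :
  to_completion N (x i) @[i --> \oo] --> completion_class x.
Proof.
apply/cvgrPdist_le => e e0.
have /asboolP/(_ e e0)[m xm] := cs_valP x.
exists m => // i /= mi.
rewrite /to_completion -linearB [leLHS]completion_norm_class.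
apply: limr_le; first exact: is_cvg_seminorm.
by exists m => // j /= mj; rewrite ltW// xm.
Qed.

Lemma norm_completion_map N M (MN : forall v, M v <= N v) (a : completion N) :
  `|completion_map MN a| <= `|a|.
Proof.
have [x ->] := completion_classP a; rewrite completion_map_class.
rewrite [leLHS]completion_norm_class [leRHS]completion_norm_class.
by apply: ler_lim; [exact: is_cvg_seminorm..|exact: nearW].
Qed.

Lemma completion_map_to N M (MN : forall v, M v <= N v) v :
  completion_map MN (to_completion N v) = to_completion M v.
Proof.
rewrite /to_completion completion_map_class; congr completion_class.
exact/val_inj.
Qed.

Lemma cvg_completion_map N M (MN : forall v, M v <= N v)
    (u : nat -> completion N) (a : completion N) : u i @[i --> \oo] --> a ->
  completion_map MN (u i) @[i --> \oo] --> completion_map MN a.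
Proof.
move=> /cvgrPdist_le ua; apply/cvgrPdist_le => e /ua; apply: filterS => i.
by apply: le_trans; rewrite -linearB norm_completion_map.
Qed.

End completions.

(** * The integral as a bilinear pairing *)

Section pairing.
Variables (R : realType) (n k : nat) (U : set 'rV[R]_n).
Implicit Types (J K : differential_chain k U) (w : kform k U).
Implicit Types (A B : nat -> chain k U).
Local Notation bhat := (Bhat k U).
Local Notation toB r := (to_completion (bnorm_seminorm k U r)).
Local Notation inj r x := (@ind_inj R (Bsystem k U) r x).

Lemma represents_exists r (x : bhat r) :
  exists A, toB r (A i) @[i --> \oo] --> x.
Proof.
by have [y ->] := completion_classP x; exists y; exact: cvg_to_completion.
Qed.

Lemma represents_inj r A (x : bhat r) :
  toB r (A i) @[i --> \oo] --> x -> represents A (inj r x).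
Proof. by exists r, x. Qed.

Lemma is_cvg_form w r A (x : bhat r) : toB r (A i) @[i --> \oo] --> x ->
  cvgn (fun i => w (A i) : R).
Proof.
move=> /cvgrPdist_lt Ax; apply/cauchy_cvgP/cauchy_exP => e e0.
have F0 : 0 < form_seminorm r w + 1 by rewrite ltr_wpDl// form_seminorm_ge0.
have [m _ mA] := Ax _ (divr_gt0 (divr_gt0 e0 (ltr0n _ 2)) F0).
exists (w (A m) : R); exists m => // i /= mi.
rewrite -ball_normE /= -linearB (le_lt_trans (form_le w r _))//.
rewrite -[bnorm r _](norm_to_completion (bnorm_seminorm k U r)) linearB.
rewrite (@le_lt_trans _ _
  ((form_seminorm r w + 1) * `|toB r (A m) - toB r (A i)|))//.
  by rewrite ler_wpM2r// lerDl.
rewrite mulrC -ltr_pdivlMr//.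
rewrite -[X in X - _](subrK x) -addrA (le_lt_trans (ler_normD _ _))//.
rewrite distrC [e]splitr mulrDl ltrD//; [exact: (mA m (leqnn m))|exact: mA].
Qed.

(** The estimate that makes the integral well defined and continuous: applied to
    the difference of two sequences with the same limit it gives uniqueness,
    applied to a representative it bounds the integral. *)
Lemma form_lim_le w r A (x : bhat r) (l : R) : toB r (A i) @[i --> \oo] --> x ->
  (w (A i) : R) @[i --> \oo] --> l -> `|l| <= form_seminorm r w * `|x|.
Proof.
move=> Ax Al.
have nl : `|w (A i) : R| @[i --> \oo] --> `|l| by exact: cvg_norm.
have nx : form_seminorm r w * `|toB r (A i)| @[i --> \oo] -->
    form_seminorm r w * `|x|.
  by apply: cvgMl_tmp; exact: cvg_norm.
rewrite -(cvg_lim _ nl)// -(cvg_lim _ nx)//.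
apply: ler_lim; [by apply: cvgP nl|by apply: cvgP nx|apply: nearW => i].
by rewrite norm_to_completion; exact: form_le.
Qed.

Lemma cvg_link r s (rs : (r <= s)%N) A (x : bhat r) :
  toB r (A i) @[i --> \oo] --> x ->
  toB s (A i) @[i --> \oo] --> Bhat_link k U rs x.
Proof.
move=> Ax; have := @cvg_completion_map _ _ (bnorm_seminorm k U r)
  (bnorm_seminorm k U s) (fun C => bnorm_mono C rs) _ _ Ax.
apply: cvg_trans; apply: near_eq_cvg; apply: nearW => i.
by rewrite completion_map_to.
Qed.

(** Two representatives of [J] may converge in different steps of the inductive
    system; they have the same limit in some later step, where their difference
    tends to 0. *)
Lemma represents_uniq w J A B (a b : R) : represents A J -> represents B J ->
  (w (A i) : R) @[i --> \oo] --> a -> (w (B i) : R) @[i --> \oo] --> b -> a = b.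
Proof.
move=> [r [x [Ax ->]]] [s [y [By xy]]] Aa Bb.
have /ind_inj_eq[m [rm [sm e]]] := xy.
have AB : toB m ((A - B) i) @[i --> \oo] --> (0 : bhat m).
  rewrite (_ : (fun i => _) = (fun i => toB m (A i) - toB m (B i))); last first.
    by apply/funext => i; rewrite -linearB.
  rewrite -(subrr (Bhat_link k U rm x)) [X in _ - X]e.
  by apply: cvgB; exact: cvg_link.
have ab : (w ((A - B) i) : R) @[i --> \oo] --> a - b.
  rewrite (_ : (fun i => _) = (fun i => (w (A i) : R) - w (B i))); last first.
    by apply/funext => i; rewrite -linearB.
  exact: cvgB.
have := form_lim_le AB ab; rewrite normr0 mulr0 normr_le0 subr_eq0.
by move=> /eqP.
Qed.

Lemma cvg_chain_integral w J A : represents A J ->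
  (w (A i) : R) @[i --> \oo] --> chain_integral J w.
Proof.
move=> AJ; have [r [x [Ax _]]] := AJ.
have wA := is_cvg_form (w := w) Ax.
rewrite /chain_integral.
case: xgetP => [l _ [B BJ Bl]|/(_ (limn (fun i => w (A i) : R)))].
  by rewrite (represents_uniq BJ AJ Bl wA).
by case; exists A.
Qed.

Lemma chain_integralP w J A (l : R) : represents A J ->
  (w (A i) : R) @[i --> \oo] --> l -> chain_integral J w = l.
Proof.
by move=> AJ; apply: (represents_uniq AJ AJ); exact: cvg_chain_integral.
Qed.

Lemma chain_integral_le w r (x : bhat r) :
  `|chain_integral (inj r x) w| <= form_seminorm r w * `|x|.
Proof.
have [A Ax] := represents_exists x.
apply: (form_lim_le Ax); exact: cvg_chain_integral (represents_inj Ax).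
Qed.

Lemma chain_integral_linearl w c J K : chain_integral (c *: J + K) w =
  c * chain_integral J w + chain_integral K w.
Proof.
have [r [x [y [-> ->]]]] := ind_limP2 J K.
have [A Ax] := represents_exists x; have [B By] := represents_exists y.
apply: (@chain_integralP _ _ (c *: A + B)).
  exists r, (c *: x + y); split; last by rewrite linearP.
  rewrite (_ : (fun i => _) = (fun i => c *: toB r (A i) + toB r (B i))).
    by apply: cvgD => //; apply: cvgZl_tmp.
  by apply/funext => i; rewrite -linearP.
rewrite (_ : (fun i => _) = (fun i => c * (w (A i) : R) + w (B i))).
  apply: cvgD; last exact: cvg_chain_integral (represents_inj By).
  by apply: cvgMl_tmp; exact: cvg_chain_integral (represents_inj Ax).
by apply/funext => i; rewrite [LHS]linearP.
Qed.

Lemma chain_integral_linearr w v c J : chain_integral J (c *: w + v) =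
  c * chain_integral J w + chain_integral J v.
Proof.
have [r [x ->]] := ind_limP J.
have [A Ax] := represents_exists x.
have AJ := represents_inj Ax.
apply: (chain_integralP AJ).
rewrite (_ : (fun i => _) = (fun i => c * (w (A i) : R) + v (A i)))//.
by apply: cvgD; [apply: cvgMl_tmp|]; exact: cvg_chain_integral.
Qed.

Lemma chain_integralZl w c J :
  chain_integral (c *: J) w = c * chain_integral J w.
Proof.
have zero : chain_integral (0 : differential_chain k U) w = 0.
  have /eqP := chain_integral_linearl w 1 0 0.
  by rewrite scale1r addr0 mul1r -subr_eq0 opprD addNKr oppr_eq0 => /eqP.
by rewrite -[c *: J]addr0 chain_integral_linearl zero addr0.
Qed.

Lemma chain_integralDl w J K :
  chain_integral (J + K) w = chain_integral J w + chain_integral K w.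
Proof. by rewrite -[J]scale1r chain_integral_linearl mul1r scale1r. Qed.

Lemma chain_integralBl w J K :
  chain_integral (J - K) w = chain_integral J w - chain_integral K w.
Proof. by rewrite chain_integralDl -scaleN1r chain_integralZl mulN1r. Qed.

Lemma chain_integralBr w v J :
  chain_integral J (w - v) = chain_integral J w - chain_integral J v.
Proof. by rewrite addrC -scaleN1r chain_integral_linearr mulN1r addrC. Qed.

Lemma chain_integralZr w c J :
  chain_integral J (c *: w) = c * chain_integral J w.
Proof.
by rewrite -[c *: w](addrK w) chain_integralBr chain_integral_linearr addrK.
Qed.

End pairing.

(** * Joint continuity of the integral along sequences *)

Lemma has_time_derivative_cvg (R : realType) (E : tvsType R) (f : R -> E) t df :
  has_time_derivative f t df -> f (t + h) @[h --> 0^'] --> f t.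
Proof.
move=> fdf; pose Q h := h^-1 *: (f (t + h) - f t).
have h0 : (h : R^o) @[h --> (0 : R)^'] --> (0 : R^o) by exact: nbhs_dnbhs.
have hQ : h *: Q h @[h --> 0^'] --> 0 *: df.
  apply: (@cvg_comp _ _ _ (fun h => (h : R^o, Q h))
    (fun z : R^o * E => z.1 *: z.2)).
    exact: cvg_pair h0 fdf.
  exact: (@scale_continuous R E ((0 : R^o), df)).
have hQf : h *: Q h + f t @[h --> 0^'] --> 0 *: df + f t.
  apply: (@cvg_comp _ _ _ (fun h => (h *: Q h, f t))
    (fun z : E * E => z.1 + z.2)).
    exact: cvg_pair hQ (cvg_cst _).
  exact: (@add_continuous E (0 *: df, f t)).
rewrite scale0r add0r in hQf.
apply: cvg_trans hQf; apply: near_eq_cvg; near=> h.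
rewrite /Q scalerA mulfV ?scale1r ?subrK//.
by near: h; exact: nbhs_dnbhs_neq.
Unshelve. all: by end_near. Qed.

Section joint.
Variables (R : realType) (n k : nat) (U : set 'rV[R]_n).
Implicit Types (J K : differential_chain k U) (w : kform k U).

Lemma form_seminorm_lt r w (e : R) :
  (form_norm r w < e%:E)%E = (form_seminorm r w < e).
Proof. by rewrite form_normE lte_fin. Qed.

Lemma cvg_form_seminorm (T : Type) (F : set_system T) {FF : Filter F}
    (f : T -> kform k U) w r :
  f x @[x --> F] --> w -> form_seminorm r (f x - w) @[x --> F] --> 0.
Proof.
move=> fw; apply/cvgrPdist_lt => e e0.
have wB : nbhs w [set v | form_seminorm r (v - w) < e].
  apply/form_nbhsP; exists [set v : kform k U | (form_norm r v < e%:E)%E].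
    by exists r, e.
  by move=> v; rewrite /= form_seminorm_lt addrC addKr.
have := fw _ wB; apply: (@filterS _ F) => x /= xe.
by rewrite sub0r normrN ger0_norm ?form_seminorm_ge0.
Qed.

Lemma form_seminormD_le r v w :
  form_seminorm r (v + w) <= form_seminorm r v + form_seminorm r w.
Proof.
have := form_norm_linE r 1 1 v w.
rewrite (scale1r v) (scale1r w) normr1 !mul1e.
rewrite (form_normE r v) (form_normE r w) (form_normE r (v + w)).
by rewrite -EFinD lee_fin.
Qed.

(** Boundedness of the forms in every seminorm, with bounds that may depend on
    the seminorm without any uniformity, is enough: membership in [ind_nbase] is
    tested on each step of the inductive system separately. *)
Lemma chain_integral_equicontinuous (w : nat -> kform k U) (M : nat -> R)
    (e : R) : 0 < e ->
  (forall r i, form_seminorm r (w i) <= M r) ->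
  ind_nbase [set J : differential_chain k U |
    forall i, `|chain_integral J (w i)| <= e].
Proof.
move=> e0 wM; split=> [a b J K We Ke ab i|r].
  rewrite chain_integralDl !chain_integralZl.
  apply: le_trans (ler_normD _ _) _; rewrite !normrM.
  apply: (@le_trans _ _ ((`|a| + `|b|) * e)).
    by rewrite mulrDl lerD// ler_wpM2l.
  by rewrite ler_piMl// ltW.
have M0 : 0 < M r + 1.
  by rewrite ltr_wpDl// (le_trans (form_seminorm_ge0 r (w 0%N))).
apply/nbhs_ballP; exists (e / (M r + 1)); first exact: divr_gt0.
move=> x; rewrite -ball_normE /= sub0r normrN ltr_pdivlMr// => xe i.
apply: le_trans (chain_integral_le _ _) _; apply: le_trans (ltW xe).
by rewrite mulrC ler_wpM2l// (le_trans (wM r i))// lerDl.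
Qed.

Lemma cvg_chain_integral_form (T : Type) (F : set_system T) {FF : Filter F}
    (f : T -> kform k U) w J :
  f x @[x --> F] --> w ->
  chain_integral J (f x) @[x --> F] --> chain_integral J w.
Proof.
move=> fw; have [r [x ->]] := ind_limP J.
have f0 : form_seminorm r (f y - w) * `|x| @[y --> F] --> 0.
  rewrite -[X in _ --> X](mul0r `|x|); apply: cvgMr_tmp.
  exact: cvg_form_seminorm.
apply/cvgrPdist_le => e e0; have /cvgrPdist_le/(_ e e0) := f0.
apply: filterS => y; rewrite sub0r normrN.
rewrite ger0_norm ?mulr_ge0 ?form_seminorm_ge0//.
apply: le_trans; apply: le_trans (chain_integral_le _ _).
by rewrite chain_integralBr distrC.
Qed.

Lemma form_seq_bounded (w : nat -> kform k U) (v : kform k U) :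
  w i @[i --> \oo] --> v ->
  exists M : nat -> R, forall r i, form_seminorm r (w i) <= M r.
Proof.
move=> wv; suff /choice[M wM] :
  forall r, exists m, forall i, form_seminorm r (w i) <= m by exists M.
move=> r.
have /cvg_seq_bounded[M [_ wM]] :
  cvgn (fun i => form_seminorm r (w i - v)).
  exact: cvgP (cvg_form_seminorm r wv).
exists (M + 1 + form_seminorm r v) => i.
rewrite -[w i](subrK v) (le_trans (form_seminormD_le _ _ _))// lerD2r.
by rewrite (le_trans (ler_norm _))// (wM (M + 1))// ltrDl.
Qed.

(** The indexing by [nat] matters: a convergent sequence of forms is bounded,
    whereas a convergent family indexed by an arbitrary filter is bounded in
    each seminorm only after discarding a part depending on the seminorm. *)
Lemma cvg_chain_integral_seq (J : nat -> differential_chain k U) K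
    (w : nat -> kform k U) (v : kform k U) :
  J i @[i --> \oo] --> K -> w i @[i --> \oo] --> v ->
  chain_integral (J i) (w i) @[i --> \oo] --> chain_integral K v.
Proof.
move=> JK wv; have [M wM] := form_seq_bounded wv.
apply/cvgrPdist_le => e e0; have e20 : 0 < e / 2 by rewrite divr_gt0.
have near_J : \forall i \near \oo, `|chain_integral (J i - K) (w i)| <= e / 2.
  have nK : nbhs K [set L | forall i, `|chain_integral (L - K) (w i)| <= e / 2].
    apply/ind_nbhsP; eexists.
      exact: (chain_integral_equicontinuous e20 wM).
    by move=> L Le i; rewrite addrC addKr.
  have := JK _ nK; apply: (@filterS _ \oo) => i; exact.
have cw : chain_integral K (w i) @[i --> \oo] --> chain_integral K v.
  exact: cvg_chain_integral_form.
have /cvgrPdist_le/(_ _ e20) near_w := cw.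
near=> i.
have -> : chain_integral (J i) (w i) =
    chain_integral (J i - K) (w i) + chain_integral K (w i).
  by rewrite chain_integralBl subrK.
rewrite opprD addrCA [e]splitr (le_trans (ler_normD _ _))// lerD//.
  by rewrite normrN; near: i.
by near: i.
Unshelve. all: by end_near. Qed.

End joint.

Unset Implicit Arguments.

Theorem theorem10p3p1 (R : realType) (n k : nat) (U : set 'rV[R]_n)
    (openU : open U)
    (T : set R) (openT : open T) (intervalT : is_interval T)
    (J J' : R -> differential_chain k U)
    (omega omega' : R -> kform k U)
    (derJ : forall t, T t -> has_time_derivative J t (J' t))
    (deromega : forall t, T t -> has_time_derivative omega t (omega' t)) :
  forall t, T t ->
    is_derive t (1 : R) (fun s => chain_integral (J s) (omega s) : R)
      (chain_integral (J' t) (omega t) + chain_integral (J t) (omega' t)).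
Proof.
move=> t Tt; set f := fun s => _; set l := _ + _.
suff fl :
  h^-1 *: ((f \o shift t) (h *: (1 : R)) - f t) @[h --> (0 : R)^'] --> l.
  by split; [apply/cvg_ex; exists l|exact: cvg_lim].
apply/cvgr_dnbhsP => h [h0 hcvg].
have hdn : h i @[i --> \oo] --> (0 : R)^'.
  move=> A /= /hcvg; apply: (@filterS _ \oo) => i hA.
  exact: hA (h0 i).
pose D i := (h i)^-1 *: (J (t + h i) - J t).
pose Q i := (h i)^-1 *: (omega (t + h i) - omega t).
have cD : D i @[i --> \oo] --> J' t by apply: cvg_comp hdn (derJ _ Tt).
have cQ : Q i @[i --> \oo] --> omega' t by apply: cvg_comp hdn (deromega _ Tt).
have comega : omega (t + h i) @[i --> \oo] --> omega t.
  exact: cvg_comp hdn (has_time_derivative_cvg (deromega _ Tt)).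
have -> : (fun i => (h i)^-1 *: ((f \o shift t) (h i *: (1 : R)) - f t)) =
    (fun i => chain_integral (D i) (omega (t + h i)) +
              chain_integral (J t) (Q i)).
  apply/funext => i; rewrite /f /= scaler1 [h i + t]addrC /D /Q.
  rewrite chain_integralZl chain_integralZr chain_integralBl chain_integralBr.
  by rewrite /GRing.scale /=; ring.
by apply: cvgD; [exact: cvg_chain_integral_seq|exact: cvg_chain_integral_form].
Qed.
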